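(* Let $(M,\Omega,\Gamma,Z,h)$ be a Joyce structure with associated formal relative connection $\mathcal{A}=h+\epsilon^{-1}v$, and let $\mathcal{A}^{\mathrm{st}}=\mathcal{H}+\epsilon^{-1}v$. Let $\dot g=\sum_{k\ge1}\dot g_k\epsilon^k\in\mathrm{Lie}(\widehat{\mathcal G})$ satisfy $e^{\mathcal L_{\dot g}}\mathcal{A}^{\mathrm{st}}=\mathcal{A}$. Then the Borel transform $$\mathcal{B}[\dot g](\xi)=\sum_{k=1}^\infty\frac{\dot g_k}{(k-1)!}\xi^{k-1}$$ converges in a neighbourhood of $\xi=0$, locally uniformly in $p\in TM$, if and only if the same holds for $\mathcal{B}[\dot g](\xi)$ when restricted to the zero section $M\subset TM$ (i.e. $\sum_{k\ge1}\frac{\dot g_k|_M}{(k-1)!}\xi^{k-1}$ converges in a neighbourhood of $\xi=0$, locally uniformly in $p\in M$). In particular, for the unique $\dot g\in\mathrm{Lie}(\widehat{\mathcal G})$ satisfying $e^{\mathcal L_{\dot g}}\mathcal{A}^{\mathrm{st}}=\mathcal{A}$ and $\dot g|_M=0$, the Borel transform $\mathcal{B}[\dot g](\xi)$ converges in a neighbourhood of $\xi=0$ locally uniformly in $p\in TM$.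
   Context: All objects and morphisms are holomorphic. $\pi:TM\to M$ is the tangent bundle projection and $V_\pi=\mathrm{Ker}(\pi_* )\subset T(TM)$ the vertical bundle. $v:\pi^*(TM)\to V_\pi$ is the canonical identification: in coordinates $(Z^i,\theta^i)$ on $TM$ induced by coordinates $(Z^i)$ on $M$, $v_{\partial_{Z^i}}=\partial_{\theta^i}$. An (Ehresmann) connection on $\pi$ is a bundle map $h:\pi^*(TM)\to T(TM)$ with $\pi_*\circ h=\mathrm{Id}$; for a local vector field $X$ on $M$, $h_X=h(X)$ denotes the lifted vector field on $TM$. It is flat if its image distribution is involutive, equivalently $[h_X,h_Y]=h_{[X,Y]}$ for all local vector fields $X,Y$ on $M$. For a holomorphic symplectic form $\Omega$ on $M$, $\Omega^v$ is the fibrewise symplectic form on $V_\pi$ with $\Omega^v(v_X,v_Y)=\Omega(X,Y)$; a connection is symplectic if its parallel transport maps between open subsets of fibres of $\pi$ preserve $\Omega^v$. A pre-Joyce structure on $(M,\Omega)$ is a connection $h$ on $\pi$ such that $\mathcal{A}^\epsilon=h+\epsilon^{-1}v$ is flat and symplectic for each $\epsilon\in\mathbb{C}^*$. A period structure on $M$ is a pair $(\Gamma,Z)$ where $\Gamma\to M$ is a bundle of full lattices in $TM$ ($\Gamma_p\subset T_pM$ a discrete finitely generated subgroup with $\Gamma_p\otimes_{\mathbb Z}\mathbb{C}=T_pM$), and $Z$ is a holomorphic vector field on $M$ with $\nabla Z=\mathrm{Id}_{TM}$, where $\nabla$ is the flat linear connection on $TM$ for which local sections of $\Gamma$ are flat.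 A Joyce structure $(M,\Omega,\Gamma,Z,h)$ is a pre-Joyce structure $(\Omega,h)$ together with a period structure $(\Gamma,Z)$ such that: (J1) $(2\pi\mathrm{i})^{-1}\Omega^{-1}$ takes integral values on the dual lattices $\Gamma^*\subset T^*M$; (J2) $h$ is invariant under translations by $(2\pi \mathrm{i})\Gamma\subset TM$; (J3) if $E$ is the $\nabla$-horizontal lift of $Z$ to $TM$, then $h([Z,X])=[E,h(X)]$ for every vector field $X$ on $M$; (J4) $h$ is invariant under the involution of $TM$ acting by $-1$ on the fibres of $\pi$. $\mathcal{H}$ is the Ehresmann connection on $\pi$ induced by $\nabla$. Formal objects: $\epsilon$ is a formal variable. $\mathrm{Lie}(\widehat{\mathcal G})$ is the set of series $\dot g=\sum_{k\ge1}\dot g_k\epsilon^k$ with each $\dot g_k$ a global vertical vector field on $TM$ (section of $V_\pi\to TM$). For a formal relative connection $\mathcal{B}=\epsilon^{-1}v+h'$, $(e^{\mathcal{L}_{\dot g}}\mathcal{B})_X=\sum_{k\ge0}\frac{1}{k!}\mathcal{L}_{\dot g}^k(\mathcal{B}_X)$ for local vector fields $X$ on $M$, with $\mathcal{L}_{\dot g}Y=[\dot g,Y]$. A series $\sum_k V_k\xi^{k-1}$ of vector fields (or sections) converges in a neighbourhood of $\xi=0$ locally uniformly in $p$ if every point has a neighbourhood $N$ and a $\delta>0$ such that, in local coordinates/frames, the series of components converges uniformly for points in $N$ and $|\xi|<\delta$. It is a fact that there is exactly one $\dot g\in\mathrm{Lie}(\widehat{\mathcal G})$ with $e^{\mathcal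 L_{\dot g}}\mathcal{A}^{\mathrm{st}}=\mathcal{A}$ and $\dot g|_M=0$. *)

(* Defs.v *)
(* Complex manifolds are given by holomorphic atlases, and every tensor field,
   bundle map or connection is given by its components in the charts together
   with its transformation law under change of chart.  A chart index is written
   a or b, a point of a chart of M is z : 'rV[R[i]]_n, and a point of the
   induced chart of TM is x = (z, theta), where theta are the coefficients of a
   tangent vector in the frame d/dz_i.  Tangent vectors of TM have coordinates
   in the same product space, the first component being the image under the
   differential of the projection TM -> M. *)
From HB Require Import structures.
From mathcomp Require Import all_boot all_order all_algebra.
From mathcomp Require Import complex.
From mathcomp Require Import all_classical all_reals all_analysis.

Set Implicit Arguments.
Unset Strict Implicit.
Unset Printing Implicit Defensive.

Import Order.TTheory GRing.Theory Num.Theory.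
Import numFieldNormedType.Exports.

Local Open Scope classical_set_scope.
Local Open Scope ring_scope.

HB.instance Definition _ (R : realType) := NormedModule.copy R[i] R[i]^o.

Notation vec R n := 'rV[R[i]]_n.
Notation tvec R n := ('rV[R[i]]_n * 'rV[R[i]]_n)%type.

(* Only used on open sets D; differentiability is over the complex numbers. *)
Definition holomorphic_on (R : realType) (V W : normedModType R[i])
  (D : set V) (f : V -> W) : Prop := forall x, D x -> differentiable f x.

Record complex_manifold (R : realType) (n : nat) := ComplexManifold {
  cm_space :> topologicalType ;
  chart_ix : Type ;
  chart_dom : chart_ix -> set cm_space ;
  chart : chart_ix -> cm_space -> vec R n ;
  (* only the values on [chart_ovl a b] below are constrained *)
  chart_trans : chart_ix -> chart_ix -> vec R n -> vec R n ;
  cm_hausdorff : hausdorff_space cm_space ;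
  cm_second_countable : @second_countable cm_space ;
  chart_dom_open : forall a, open (chart_dom a) ;
  chart_cover : forall p, exists a, chart_dom a p ;
  chart_inj : forall a p q,
    chart_dom a p -> chart_dom a q -> chart a p = chart a q -> p = q ;
  chart_cont : forall a p, chart_dom a p -> {for p, continuous (chart a)} ;
  chart_open : forall a (V : set cm_space),
    open V -> V `<=` chart_dom a -> open (chart a @` V) ;
  chart_transE : forall a b p, chart_dom a p -> chart_dom b p ->
    chart_trans a b (chart a p) = chart b p ;
  chart_trans_holo : forall a b,
    holomorphic_on (chart a @` (chart_dom a `&` chart_dom b)) (chart_trans a b)
}.

Definition chart_img (R : realType) (n : nat) (M : complex_manifold R n)
  (a : chart_ix M) : set (vec R n) := chart a @` chart_dom a.

Definition chart_ovl (R : realType) (n : nat) (M : complex_manifold R n)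
  (a b : chart_ix M) : set (vec R n) :=
  chart a @` (chart_dom a `&` chart_dom b).

Definition tchart_img (R : realType) (n : nat) (M : complex_manifold R n)
  (a : chart_ix M) : set (tvec R n) := [set x | chart_img a x.1].

Definition tchart_ovl (R : realType) (n : nat) (M : complex_manifold R n)
  (a b : chart_ix M) : set (tvec R n) := [set x | chart_ovl a b x.1].

Definition tchart_trans (R : realType) (n : nat) (M : complex_manifold R n)
  (a b : chart_ix M) (x : tvec R n) : tvec R n :=
  (chart_trans a b x.1, 'd (chart_trans a b) (x.1) x.2).

(* Vector fields on M and on TM. *)

Definition is_vfield (R : realType) (V : normedModType R[i]) (I : Type)
  (img : I -> set V) (ovl : I -> I -> set V) (trans : I -> I -> V -> V)
  (X : I -> V -> V) : Prop :=
  (forall a, holomorphic_on (img a) (X a)) /\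
  (forall a b x, ovl a b x -> X b (trans a b x) = 'd (trans a b) x (X a x)).

Definition base_vfield (R : realType) (n : nat) (M : complex_manifold R n)
  (X : chart_ix M -> vec R n -> vec R n) : Prop :=
  is_vfield (@chart_img R n M) (@chart_ovl R n M) (@chart_trans R n M) X.

Definition vertical_vfield (R : realType) (n : nat) (M : complex_manifold R n)
  (X : chart_ix M -> tvec R n -> tvec R n) : Prop :=
  is_vfield (@tchart_img R n M) (@tchart_ovl R n M) (@tchart_trans R n M) X /\
  (forall a x, tchart_img a x -> (X a x).1 = 0).

(* A local vector field on M, in the chart a.  As all the conditions imposed
   below on local vector fields are pointwise, fields defined on open subsets
   of charts are enough. *)
Definition local_vfield (R : realType) (n : nat) (M : complex_manifold R n)
  (a : chart_ix M) (U : set (vec R n)) (X : vec R n -> vec R n) : Prop :=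
  [/\ open U, U `<=` chart_img a & holomorphic_on U X].

Definition bracket (R : realType) (V : normedModType R[i])
  (X Y : V -> V) (x : V) : V := 'd Y x (X x) - 'd X x (Y x).

(* Bundle maps pi^*(TM) -> T(TM). *)

Definition bundle_map (R : realType) (n : nat) (M : complex_manifold R n) :=
  chart_ix M -> tvec R n -> vec R n -> tvec R n.

Record connection (R : realType) (n : nat) (M : complex_manifold R n)
    (h : bundle_map M) : Prop := {
  connection_linear : forall a x, tchart_img a x ->
    forall (c : R[i]) u w, h a x (c *: u + w) = c *: h a x u + h a x w ;
  connection_holo : forall a u, holomorphic_on (tchart_img a) (h a ^~ u) ;
  connection_proj : forall a x, tchart_img a x -> forall u, (h a x u).1 = u ;
  connection_trans : forall a b x, tchart_ovl a b x -> forall u,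
    'd (tchart_trans a b) x (h a x u) =
    h b (tchart_trans a b x) ('d (chart_trans a b) (x.1) u)
}.

Definition vmap (R : realType) (n : nat) (M : complex_manifold R n) :
  bundle_map M := fun a x u => (0, u).

Definition lift (R : realType) (n : nat) (M : complex_manifold R n)
  (h : bundle_map M) (a : chart_ix M) (X : vec R n -> vec R n)
  (x : tvec R n) : tvec R n := h a x (X x.1).

Definition flat (R : realType) (n : nat) (M : complex_manifold R n)
  (h : bundle_map M) : Prop :=
  forall a U X Y, local_vfield a U X -> local_vfield a U Y ->
  forall x : tvec R n, U x.1 ->
    bracket (lift h a X) (lift h a Y) x = lift h a (bracket X Y) x.

Definition A_eps (R : realType) (n : nat) (M : complex_manifold R n)
  (h : bundle_map M) (eps : R[i]) : bundle_map M :=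
  fun a x u => h a x u + eps^-1 *: vmap a x u.

Definition form (R : realType) (n : nat) (W : 'M[R[i]]_n) (u w : vec R n) :
  R[i] := (u *m W *m w^T) ord0 ord0.

(* (omega a z) i j = Omega (d/dz_i) (d/dz_j) *)
Record symplectic_form (R : realType) (n : nat) (M : complex_manifold R n)
    (omega : chart_ix M -> vec R n -> 'M[R[i]]_n) : Prop := {
  sform_holo : forall a, holomorphic_on (chart_img a) (omega a) ;
  sform_trans : forall a b z, chart_ovl a b z -> forall u w,
    form (omega b (chart_trans a b z))
      ('d (chart_trans a b) z u) ('d (chart_trans a b) z w) =
    form (omega a z) u w ;
  sform_alt : forall a z, chart_img a z -> (omega a z)^T = - omega a z ;
  sform_nondeg : forall a z, chart_img a z -> omega a z \in unitmx ;
  sform_closed : forall a z, chart_img a z -> forall i j k : 'I_n,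
    ('d (omega a) z (delta_mx ord0 i)) j k
    + ('d (omega a) z (delta_mx ord0 j)) k i
    + ('d (omega a) z (delta_mx ord0 k)) i j = 0
}.

(* Parallel transport, along C^1 paths parametrised by the real interval
   [0, 1]; derivatives are one-sided at the endpoints. *)

Definition path_deriv (R : realType) (V : normedModType R[i])
  (f : R -> V) (t : R) (l : V) : Prop :=
  (fun s : R => ((s - t)^-1)%:C%C *: (f s - f t)) @ within `[0, 1] t^' --> l.

Definition C1_path (R : realType) (n : nat) (M : complex_manifold R n)
  (c : R -> M) (c' : chart_ix M -> R -> vec R n) : Prop :=
  {within `[0, 1], continuous c} /\
  (forall a (t : R), t \in `[0, 1] -> chart_dom a (c t) ->
     path_deriv (chart a \o c) t (c' a t) /\
     c' a @ within `[0, 1] (nbhs t) --> c' a t).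

(* P a t : coordinates in the chart a of a tangent vector at the point c t *)
Definition horizontal_lift (R : realType) (n : nat) (M : complex_manifold R n)
  (h : bundle_map M) (c : R -> M) (c' P : chart_ix M -> R -> vec R n) : Prop :=
  forall t : R, t \in `[0, 1] ->
  (forall a b, chart_dom a (c t) -> chart_dom b (c t) ->
     P b t = 'd (chart_trans a b) (chart a (c t)) (P a t)) /\
  (forall a, chart_dom a (c t) ->
     path_deriv (fun s => (chart a (c s), P a s)) t
       (h a (chart a (c t), P a t) (c' a t))).

(* f is, in the charts a0 and a1, the parallel transport along c from the open
   subset W of the fibre over c 0 to the fibre over c 1. *)
Definition parallel_transport (R : realType) (n : nat)
  (M : complex_manifold R n) (h : bundle_map M) (c : R -> M)
  (c' : chart_ix M -> R -> vec R n) (a0 a1 : chart_ix M)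
  (W : set (vec R n)) (f : vec R n -> vec R n) : Prop :=
  [/\ open W, chart_dom a0 (c 0), chart_dom a1 (c 1) &
      forall w, W w -> exists P,
        [/\ horizontal_lift h c c' P, P a0 0 = w & P a1 1 = f w]].

(* The form Omega^v restricts on the fibre over p to the constant form with
   value Omega_p. *)
Definition symplectic_connection (R : realType) (n : nat)
  (M : complex_manifold R n) (omega : chart_ix M -> vec R n -> 'M[R[i]]_n)
  (h : bundle_map M) : Prop :=
  forall c c' a0 a1 W f, C1_path c c' -> parallel_transport h c c' a0 a1 W f ->
  forall w, W w -> forall u u',
    form (omega a1 (chart a1 (c 1))) ('d f w u) ('d f w u') =
    form (omega a0 (chart a0 (c 0))) u u'.

Record pre_Joyce (R : realType) (n : nat) (M : complex_manifold R n)
    (omega : chart_ix M -> vec R n -> 'M[R[i]]_n) (h : bundle_map M) : Prop := {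
  pre_Joyce_form : symplectic_form omega ;
  pre_Joyce_connection : connection h ;
  pre_Joyce_flat : forall eps : R[i], eps != 0 -> flat (A_eps h eps) ;
  pre_Joyce_symplectic : forall eps : R[i], eps != 0 ->
    symplectic_connection omega (A_eps h eps)
}.

(* Period structures. *)

Definition lattice_basis (R : realType) (n : nat)
  (B : 'M[R[i]]_n) (L : set (vec R n)) : Prop :=
  B \in unitmx /\ L = [set map_mx intr m *m B | m in [set: 'rV[int]_n]].

(* A finitely generated subgroup L of C^n is free, and the natural map
   from L (x) C to C^n is bijective iff a Z-basis of L (the rows of the matrix
   in [lattice_basis]) is a C-basis of C^n. *)
Definition full_lattice (R : realType) (n : nat) (L : set (vec R n)) : Prop :=
  (exists2 e : R[i], 0 < e & forall u, L u -> `|u| < e -> u = 0) /\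
  (exists B, lattice_basis B L).

Record lattice_bundle (R : realType) (n : nat) (M : complex_manifold R n)
    (Gamma : chart_ix M -> vec R n -> set (vec R n)) : Prop := {
  lattice_full : forall a z, chart_img a z -> full_lattice (Gamma a z) ;
  lattice_trans : forall a b z, chart_ovl a b z ->
    Gamma b (chart_trans a b z) = 'd (chart_trans a b) z @` Gamma a z ;
  lattice_local_frame : forall a z, chart_img a z ->
    exists U (B : vec R n -> 'M[R[i]]_n),
      [/\ open U, U z, U `<=` chart_img a, holomorphic_on U B &
          forall y, U y -> lattice_basis (B y) (Gamma a y)]
}.

Definition lattice_section (R : realType) (n : nat) (M : complex_manifold R n)
  (Gamma : chart_ix M -> vec R n -> set (vec R n))
  (a : chart_ix M) (U : set (vec R n)) (s : vec R n -> vec R n) : Prop :=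
  local_vfield a U s /\ (forall z, U z -> Gamma a z (s z)).

(* A linear connection nabla on TM is given by its Christoffel symbols:
   nabla_X Y = 'd Y (X) + G (X, Y). *)
Definition christoffel (R : realType) (n : nat) (M : complex_manifold R n) :=
  chart_ix M -> vec R n -> vec R n -> vec R n -> vec R n.

Definition nabla (R : realType) (n : nat) (M : complex_manifold R n)
  (G : christoffel M) (a : chart_ix M) (z u : vec R n)
  (Y : vec R n -> vec R n) : vec R n := 'd Y z u + G a z u (Y z).

(* the Ehresmann connection induced by nabla *)
Definition Hconn (R : realType) (n : nat) (M : complex_manifold R n)
  (G : christoffel M) : bundle_map M := fun a x u => (u, - G a x.1 u x.2).

(* The transformation law of the Christoffel symbols, their holomorphy and
   their linearity in u are those of the connection [Hconn G]. *)
Record linear_connection (R : realType) (n : nat) (M : complex_manifold R n)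
    (G : christoffel M) : Prop := {
  linear_connection_conn : connection (Hconn G) ;
  linear_connection_linear : forall a z, chart_img a z ->
    forall u (c : R[i]) y w, G a z u (c *: y + w) = c *: G a z u y + G a z u w
}.

(* G is determined by Gamma, as Gamma has local frames. *)
Record period_structure (R : realType) (n : nat) (M : complex_manifold R n)
    (Gamma : chart_ix M -> vec R n -> set (vec R n)) (G : christoffel M)
    (Z : chart_ix M -> vec R n -> vec R n) : Prop := {
  period_lattice : lattice_bundle Gamma ;
  period_connection : linear_connection G ;
  period_flat : flat (Hconn G) ;
  period_lattice_flat : forall a U s, lattice_section Gamma a U s ->
    forall z, U z -> forall u, nabla G a z u s = 0 ;
  period_vfield : base_vfield Z ;
  period_nabla : forall a z, chart_img a z -> forall u,
    nabla G a z u (Z a) = u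
}.

(* Joyce structures. *)

Definition two_pi_i (R : realType) : R[i] := Complex 0 (2 * pi).

Definition is_integer (R : realType) (c : R[i]) : Prop :=
  exists k : int, c = k%:~R.

(* covectors are row vectors of components, with alpha(u) = u *m alpha^T *)
Definition dual_lattice (R : realType) (n : nat) (L : set (vec R n)) :
  set (vec R n) :=
  [set alpha | forall u, L u -> is_integer ((u *m alpha^T) ord0 ord0)].

Definition fibre_translation (R : realType) (n : nat)
  (s : vec R n -> vec R n) (x : tvec R n) : tvec R n :=
  (x.1, x.2 + two_pi_i R *: s x.1).

Definition fibre_involution (R : realType) (n : nat) (x : tvec R n) :
  tvec R n := (x.1, - x.2).

Record Joyce_structure (R : realType) (n : nat) (M : complex_manifold R n)
    (omega : chart_ix M -> vec R n -> 'M[R[i]]_n)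
    (Gamma : chart_ix M -> vec R n -> set (vec R n)) (G : christoffel M)
    (Z : chart_ix M -> vec R n -> vec R n) (h : bundle_map M) : Prop := {
  Joyce_pre : pre_Joyce omega h ;
  Joyce_period : period_structure Gamma G Z ;
  Joyce_J1 : forall a z, chart_img a z -> forall alpha beta,
    dual_lattice (Gamma a z) alpha -> dual_lattice (Gamma a z) beta ->
    is_integer ((two_pi_i R)^-1 * form (invmx (omega a z)) alpha beta) ;
  Joyce_J2 : forall a U s, lattice_section Gamma a U s ->
    forall x : tvec R n, U x.1 -> forall u,
      'd (fibre_translation s) x (h a x u) = h a (fibre_translation s x) u ;
  Joyce_J3 : forall a U X, local_vfield a U X ->
    forall x : tvec R n, U x.1 ->
      lift h a (bracket (Z a) X) x =
      bracket (lift (Hconn G) a (Z a)) (lift h a X) x ;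
  Joyce_J4 : forall a (x : tvec R n), tchart_img a x -> forall u,
    'd (@fibre_involution R n) x (h a x u) = h a (fibre_involution x) u
}.

(* Formal series in eps.  The coefficient of eps^k in g is g k for k >= 1, and
   g 0 is never used.  Series of local vector fields on TM start at eps^-1:
   Y j is the coefficient of eps^(j-1). *)

Definition Lie_G (R : realType) (n : nat) (M : complex_manifold R n)
  (g : nat -> chart_ix M -> tvec R n -> tvec R n) : Prop :=
  forall k, (0 < k)%N -> vertical_vfield (g k).

Definition formal_Lie (R : realType) (n : nat) (M : complex_manifold R n)
  (g : nat -> chart_ix M -> tvec R n -> tvec R n) (a : chart_ix M)
  (Y : nat -> tvec R n -> tvec R n) : nat -> tvec R n -> tvec R n :=
  fun j x => \sum_(1 <= k < j.+1) bracket (g k a) (Y (j - k)%N) x.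

(* formal_Lie raises the order in eps by at least one, so its k-th iterate does
   not contribute to the coefficient j when k > j. *)
Definition exp_formal_Lie (R : realType) (n : nat) (M : complex_manifold R n)
  (g : nat -> chart_ix M -> tvec R n -> tvec R n) (a : chart_ix M)
  (Y : nat -> tvec R n -> tvec R n) : nat -> tvec R n -> tvec R n :=
  fun j x => \sum_(k < j.+1) (k`!%:R)^-1 *: iter k (formal_Lie g a) Y j x.

(* the lift of X by the formal relative connection eps^-1 v + h *)
Definition formal_lift (R : realType) (n : nat) (M : complex_manifold R n)
  (h : bundle_map M) (a : chart_ix M) (X : vec R n -> vec R n) :
  nat -> tvec R n -> tvec R n :=
  fun j => match j with
           | 0 => lift (@vmap R n M) a X
           | 1 => lift h a X
           | _ => fun=> 0
           end.

(* exp(L_g) (eps^-1 v + h0) = eps^-1 v + h1 *)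
Definition gauge_relates (R : realType) (n : nat) (M : complex_manifold R n)
  (g : nat -> chart_ix M -> tvec R n -> tvec R n) (h0 h1 : bundle_map M) :
  Prop :=
  forall a U X, local_vfield a U X -> forall j (x : tvec R n), U x.1 ->
    exp_formal_Lie g a (formal_lift h0 a X) j x = formal_lift h1 a X j x.

(* The series \sum_(k >= 1) (f k / (k - 1)!) xi^(k-1), re-indexed from 0,
   converges uniformly near x0 in D and for small xi. *)
Definition borel_converges_near (R : realType) (V W : normedModType R[i])
  (D : set V) (f : nat -> V -> W) (x0 : V) : Prop :=
  exists (N : set V) (delta : R[i]) (S : V * R[i] -> W),
    [/\ nbhs x0 N, 0 < delta &
      {uniform [set y | [/\ N y.1, D y.1 & `|y.2| < delta]],
        (fun (m : nat) (y : V * R[i]) =>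
           \sum_(k < m) (y.2 ^+ k / k`!%:R) *: f k.+1 y.1) @ \oo --> S}].

Definition borel_converges (R : realType) (n : nat) (M : complex_manifold R n)
  (g : nat -> chart_ix M -> tvec R n -> tvec R n) : Prop :=
  forall a x, tchart_img a x ->
    borel_converges_near (tchart_img a) (fun k => g k a) x.

Definition zero_section_converges (R : realType) (n : nat)
  (M : complex_manifold R n)
  (g : nat -> chart_ix M -> tvec R n -> tvec R n) : Prop :=
  forall a z, chart_img a z ->
    borel_converges_near (chart_img a) (fun k y => g k a (y, 0)) z.

Definition vanishes_on_zero_section (R : realType) (n : nat)
  (M : complex_manifold R n)
  (g : nat -> chart_ix M -> tvec R n -> tvec R n) : Prop :=
  forall k, (0 < k)%N -> forall a z, chart_img a z -> g k a (z, 0) = 0.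

(* Main.v *)
(* Fix a chart, and for a constant vector field u put U = [g, A^st_u].  Unrolling
   exp(ad g) A^st = A gives U = (h_u - H_u) eps^0 - sum_(k >= 2) (ad g)^(k-1) U / k!,
   which determines U_j from the g_k and U_k with k < j; on the other hand
   U_j = [g_j, v_u] + [g_(j-1), H_u] with [g_j, v_u] = - d g_j (0, u), so g_j is
   recovered from its values on the zero section by integrating U_j along the
   fibres.  Suppose that g_k and U_k are bounded by multiples of
   l^k (k-1)! / (k^2 (r0 - r)^(k-1)) on domains D r, r < r0, stable under contraction
   of the fibres.  By Cauchy's estimate a derivative turns the weight of order k into
   k! / (r0 - r)^k, hence the bracket of coefficients of orders k and i satisfies the
   bound of order k + i, up to a constant: each application of ad g multiplies
   the bounds by a fixed factor, which is small when the bound on g is.  Hence the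
   estimate propagates by induction for l large, and it says that g is Gevrey of
   order 1, that is, that its Borel transform converges. *)
Require Import Defs.
From HB Require Import structures.
From mathcomp Require Import all_boot all_order all_algebra.
From mathcomp Require Import complex.
From mathcomp Require Import all_classical all_reals all_analysis.
From mathcomp Require Import ring lra.

Set Implicit Arguments.
Unset Strict Implicit.
Unset Printing Implicit Defensive.

Import Order.TTheory GRing.Theory Num.Theory.
Import numFieldNormedType.Exports.

Local Open Scope classical_set_scope.
Local Open Scope ring_scope.
Local Open Scope complex_scope.

(** * Norms of complex normed modules as real numbers *)

(** The obstacle is the loss of derivatives: every bracket differentiates, and order j contains up
    to j nested brackets. Bounds are therefore kept for all radii r < r0 at once, and each
    derivative chooses its own loss of radius, (r0 - r) / 2k at order k; no sequence of domains has
    to be fixed in advance. The weights 1 / k^2 prevent the sum over k + i = j from contributing a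
    factor j at each bracket: their convolution is again O(1 / j^2). Passing from U_j to g_j loses
    nothing, because integration along a fibre stays in the same D r and keeps the weight; the term
    [g_(j-1), H_u] spends one derivative, but on a coefficient of order j - 1. Nested brackets must
    also be holomorphic again. Everything is drawn from complex differentiability at each point:
    Goursat's argument on squares gives Cauchy's estimate in one variable, restriction to complex
    lines gives it in several, and derivatives are holomorphic as uniform limits of difference
    quotients. The constants 24, 96 and 192 record the losses along this way. *)

Section RealNorm.
Variable R : realType.
Implicit Types V W : normedModType R[i].

(* Norms take their values in the partially ordered R[i]; [rn] is the norm as a
   real number. *)
Definition rn V (x : V) : R := complex.Re `|x|.

Lemma rnE V (x : V) : (rn x)%:C = `|x|.
Proof. by rewrite /rn RRe_real// ger0_real. Qed.

Lemma rn_ge0 V (x : V) : 0 <= rn x.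
Proof. by rewrite -lecR rnE normr_ge0. Qed.

Lemma rnD V (x y : V) : rn (x + y) <= rn x + rn y.
Proof. by rewrite -lecR rmorphD /= !rnE ler_normD. Qed.

Lemma rnN V (x : V) : rn (- x) = rn x.
Proof. by rewrite /rn normrN. Qed.

Lemma rnB V (x y : V) : rn (x - y) <= rn x + rn y.
Proof. by rewrite -(rnN y) rnD. Qed.

Lemma rn_distC V (x y : V) : rn (x - y) = rn (y - x).
Proof. by rewrite -rnN opprB. Qed.

Lemma rn0 V : rn (0 : V) = 0.
Proof. by rewrite /rn normr0. Qed.

Lemma rnZ V (c : R[i]) (x : V) : rn (c *: x) = rn c * rn x.
Proof. by apply: (@complexI R); rewrite rmorphM /= !rnE normrZ. Qed.

Lemma rnM (c d : R[i]) : rn (c * d) = rn c * rn d.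
Proof. by apply: (@complexI R); rewrite rmorphM /= !rnE normrM. Qed.

Lemma rn1 : rn (1 : R[i]) = 1.
Proof. by rewrite /rn normr1. Qed.

Lemma rnV (c : R[i]) : rn (c^-1) = (rn c)^-1.
Proof. by apply: (@complexI R); rewrite fmorphV /= !rnE normfV. Qed.

Lemma rnX (c : R[i]) k : rn (c ^+ k) = rn c ^+ k.
Proof. by elim: k => [|k IH]; rewrite ?expr0 ?rn1// !exprS rnM IH. Qed.

Lemma rn_eq0 V (x : V) : rn x = 0 -> x = 0.
Proof. by move=> x0; apply/normr0_eq0; rewrite -rnE x0. Qed.

Lemma rn_gt0 V (x : V) : x != 0 -> 0 < rn x.
Proof.
move=> x0; rewrite lt_neqAle rn_ge0 andbT eq_sym.
by apply: contraNneq x0 => /rn_eq0 ->.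
Qed.

Lemma rn_sum V (I : Type) (r : seq I) (P : pred I) (F : I -> V) :
  rn (\sum_(i <- r | P i) F i) <= \sum_(i <- r | P i) rn (F i).
Proof.
elim/big_rec2: _ => [|i x y _ IH]; first by rewrite rn0.
by rewrite (le_trans (rnD _ _))// lerD2l.
Qed.

Lemma rn_real (t : R) : rn t%:C = `|t|.
Proof. by apply: (@complexI R); rewrite rnE normc_def /= expr0n addr0 sqrtr_sqr. Qed.

Lemma rn_nat (n : nat) : rn (n%:R : R[i]) = n%:R.
Proof. by apply: (@complexI R); rewrite rnE normr_nat rmorph_nat. Qed.

Lemma rnZr V (t : R) (x : V) : rn (t%:C *: x) = `|t| * rn x.
Proof. by rewrite rnZ rn_real. Qed.

Lemma ball_rn V (x y : V) (e : R) : ball x e%:C y = (rn (x - y) < e) :> Prop.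
Proof. by rewrite -ball_normE /ball_ /= -rnE ltcR. Qed.

Lemma nbhs_rn V (x : V) (A : set V) :
  nbhs x A <-> exists2 e : R, 0 < e & forall y, rn (y - x) < e -> A y.
Proof.
split.
  move=> /nbhs_ballP[e /= e0 eA]; exists (complex.Re e).
    by rewrite -ltcR RRe_real// gtr0_real.
  move=> y yx; apply: eA; rewrite -[e]RRe_real ?gtr0_real// ball_rn.
  by rewrite rn_distC.
move=> [e e0 eA]; apply/nbhs_ballP; exists e%:C; rewrite /= ?ltcR//.
by move=> y; rewrite ball_rn rn_distC; apply: eA.
Qed.

Lemma open_rn V (A : set V) : open A -> forall x, A x ->
  exists2 e : R, 0 < e & forall y, rn (y - x) < e -> A y.
Proof. by move=> oA x Ax; apply/nbhs_rn/open_nbhs_nbhs. Qed.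

Lemma Re_rn (c : R[i]) : `|complex.Re c| <= rn c.
Proof. by rewrite -lecR rnE normc_ge_Re. Qed.

Lemma Im_rn (c : R[i]) : `|complex.Im c| <= rn c.
Proof.
rewrite -lecR rnE normc_def lecR -sqrtr_sqr ler_wsqrtr// lerDr sqr_ge0//.
Qed.

Lemma rn_i : rn ('i : R[i]) = 1.
Proof. by apply: (@complexI R); rewrite rnE normc_def /= expr0n add0r expr1n sqrtr1. Qed.

Lemma rn_ReIm (c : R[i]) : rn c <= `|complex.Re c| + `|complex.Im c|.
Proof.
by rewrite [c in rn c]complexE (le_trans (rnD _ _))// rnM rn_i !rn_real mul1r.
Qed.

Lemma diff_rn V W (f : V -> W) (x : V) : differentiable f x ->
  forall e : R, 0 < e -> exists2 d : R, 0 < d &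
  forall v, rn v < d -> rn (f (x + v) - f x - 'd f x v) <= e * rn v.
Proof.
move=> /diff_locally/eqaddoP fx e e0.
have eC : 0 < e%:C by rewrite ltcR.
have /nbhs_rn[d d0 dP] := fx _ eC.
exists d => // v vd; have := dP v; rewrite subr0 => /(_ vd) /=.
rewrite -lecR rmorphM /= !rnE /= !fctE /=.
by rewrite opprD addrA [v + x]addrC.
Qed.

Lemma bounded_linear_rn V W (L : {linear V -> W}) (C : R) :
  (forall v, rn (L v) <= C * rn v) -> continuous L.
Proof.
move=> LC; have C1 : 0 < `|C| + 1 by rewrite ltr_pwDr.
move=> x; apply/cvg_ballP => e e0; apply/nbhs_rn.
have e0' : 0 < complex.Re e by rewrite -ltcR RRe_real// gtr0_real.
exists (complex.Re e / (`|C| + 1)); first exact: divr_gt0.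
move=> y yx; rewrite -[e]RRe_real ?gtr0_real// ball_rn -raddfB.
rewrite rn_distC in yx.
move: yx; rewrite ltr_pdivlMr// => yx.
apply: le_lt_trans (LC _) _; apply: le_lt_trans yx.
rewrite mulrC ler_wpM2l ?rn_ge0//.
by rewrite (le_trans (ler_norm _))// lerDl.
Qed.

Lemma diff_bound V W (f : V -> W) (x : V) : differentiable f x ->
  exists2 C : R, 0 <= C & forall v, rn ('d f x v) <= C * rn v.
Proof.
move=> fx.
have := diff_continuous fx => /(_ 0)/cvg_ballP/(_ 1 ltr01)/nbhs_rn[d d0 dP].
(* Vectors of norm d / 2 are sent into the unit ball; homogeneity gives the factor 2 / d. *)
exists (2 / d); first by rewrite divr_ge0// ltW.
move=> v; have [->|v0] := eqVneq v 0; first by rewrite linear0 !rn0 mulr0.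
have rv := rn_gt0 v0.
have := dP ((d / (2 * rn v))%:C *: v).
rewrite subr0 rnZr ger0_norm; last by rewrite divr_ge0 ?mulr_ge0 ?ltW.
have -> : d / (2 * rn v) * rn v = d / 2 by field; rewrite gt_eqF.
have -> : (d / 2 < d) by rewrite ltr_pdivrMr// ltr_pMr// ltr1n.
move=> /(_ isT); rewrite -[1]/(1%:C) ball_rn linear0 sub0r rnN linearZ rnZr.
rewrite ger0_norm; last by rewrite divr_ge0 ?mulr_ge0 ?ltW.
rewrite mulrC mulrA ltr_pdivrMr ?mulr_gt0// mul1r => H.
by rewrite mulrAC ler_pdivlMr// ltW.
Qed.

(** [L] is a bare function: its linear structure and its continuity are built from the hypotheses.
    This serves in particular for a differential obtained as a pointwise limit. *)
Lemma rn_differentiable V W (f L : V -> W) (x : V) (C : R) :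
  linear L -> (forall v, rn (L v) <= C * rn v) ->
  (forall e : R, 0 < e -> exists2 d : R, 0 < d &
  forall v, rn v < d -> rn (f (x + v) - f x - L v) <= e * rn v) ->
  differentiable f x /\ 'd f x = L :> (V -> W).
Proof.
move=> linL LC fL.
pose L' : {linear V -> W} := HB.pack L (GRing.isLinear.Build _ _ _ _ L linL).
have cL : continuous L' by exact: (@bounded_linear_rn _ _ _ C).
have fE : f \o shift x = cst (f x) + L' +o_ 0 id.
  apply/eqaddoP => e e0.
  have e0' : 0 < complex.Re e by rewrite -ltcR RRe_real// gtr0_real.
  have [d d0 dP] := fL _ e0'; apply/nbhs_rn; exists d => // v; rewrite subr0 => vd.
  rewrite -[e]RRe_real ?gtr0_real// /= -!rnE /= -rmorphM/= lecR.
  by rewrite !fctE /= opprD addrA [v + x]addrC; exact: dP.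
have dE : 'd f x = L' :> (V -> W) by exact: diff_unique.
by split => //; apply/diff_locallyP; split; rewrite dE.
Qed.

Lemma rn_row n (x : 'rV[R[i]]_n) i : rn (x 0 i) <= rn x.
Proof.
rewrite -lecR !rnE [leRHS]/Num.norm/= mx_normE -[leLHS]nngE num_le.
exact: (le_bigmax _ _ (0, i)).
Qed.

Lemma rn_row_le n (x : 'rV[R[i]]_n) (C : R) : 0 <= C ->
  (forall i, rn (x 0 i) <= C) -> rn x <= C.
Proof.
move=> C0 xC; have [->|x0] := eqVneq x 0; first by rewrite rn0.
have : mx_norm x != 0 by apply: contra_neq x0; apply: mx_norm_eq0.
move=> /mx_norm_neq0[[i j] /= xE]; rewrite -lecR rnE [leLHS]/Num.norm/= xE.
by rewrite ord1 -rnE lecR.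
Qed.

Lemma rn_pair V W (x : V * W) : rn x = Num.max (rn x.1) (rn x.2).
Proof.
apply: (@complexI R); rewrite rnE prod_normE -!rnE.
by case: (leP (rn x.1) (rn x.2)) => h; [rewrite max_r// lecR| rewrite max_l// lecR ltW].
Qed.

Lemma rn_fst V W (x : V * W) : rn x.1 <= rn x.
Proof. by rewrite rn_pair le_max lexx. Qed.

Lemma rn_snd V W (x : V * W) : rn x.2 <= rn x.
Proof. by rewrite rn_pair le_max lexx orbT. Qed.

Lemma rn_pair_le V W (x : V * W) C : rn x.1 <= C -> rn x.2 <= C -> rn x <= C.
Proof. by move=> h1 h2; rewrite rn_pair ge_max h1. Qed.

Lemma differentiable_rn_continuous V W (f : V -> W) x : differentiable f x ->
  forall e : R, 0 < e -> exists2 d : R, 0 < d &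
    forall y, rn (y - x) < d -> rn (f y - f x) < e.
Proof.
move=> /differentiable_continuous/cvg_ballP fx e e0.
have eC : 0 < e%:C by rewrite ltcR.
have /nbhs_rn[d d0 dP] := fx _ eC.
by exists d => // y /dP; rewrite ball_rn rn_distC.
Qed.

Section tvec_coordinates.
Variable n : nat.

(** Norms of row vectors and of pairs are maxima, so bounding each scalar coordinate bounds the
    vector without a factor of n. Scalar complex analysis is applied through these coordinates. *)
Definition coord_tvec (i : 'I_n + 'I_n) (w : tvec R n) : R[i] :=
  match i with inl i => w.1 0 i | inr i => w.2 0 i end.

Definition tvec_of_coord (a : 'I_n + 'I_n -> R[i]) : tvec R n :=
  (\row_i a (inl i), \row_i a (inr i)).

Lemma tvec_of_coordK a i : coord_tvec i (tvec_of_coord a) = a i.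
Proof. by case: i => i; rewrite /= mxE. Qed.

Lemma coord_tvecB i u w : coord_tvec i (u - w) = coord_tvec i u - coord_tvec i w.
Proof. by case: i => i; rewrite /= !mxE. Qed.

Lemma coord_tvecZ i c u : coord_tvec i (c *: u) = c * coord_tvec i u.
Proof. by case: i => i; rewrite /= !mxE. Qed.

Lemma rn_coord_tvec i w : rn (coord_tvec i w) <= rn w.
Proof.
case: i => i /=; rewrite (le_trans (rn_row _ _))//; [exact: rn_fst|exact: rn_snd].
Qed.

Lemma rn_tvec_le w C : 0 <= C -> (forall i, rn (coord_tvec i w) <= C) -> rn w <= C.
Proof.
move=> C0 wC; apply: rn_pair_le; apply: rn_row_le => // i;
 [exact: (wC (inl i))|exact: (wC (inr i))].
Qed.

End tvec_coordinates.

End RealNorm.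

(** * Cauchy's estimate in one variable *)

Section LineIntegral.
Variable R : realType.
Implicit Types (a b c d : R) (k : R -> R[i]).

Definition cint a b k : R[i] :=
  Complex (\int[@lebesgue_measure R]_(x in `[a, b]) complex.Re (k x))
          (\int[@lebesgue_measure R]_(x in `[a, b]) complex.Im (k x)).

Definition cont_itv a b k := forall t, a <= t <= b -> forall e : R, 0 < e ->
  exists2 d : R, 0 < d & forall s, a <= s <= b -> `|s - t| < d -> rn (k s - k t) < e.

Lemma ReB (u v : R[i]) : complex.Re (u - v) = complex.Re u - complex.Re v.
Proof. by case: u; case: v. Qed.

Lemma ImB (u v : R[i]) : complex.Im (u - v) = complex.Im u - complex.Im v.
Proof. by case: u; case: v. Qed.

Lemma within_continuous_itv a b (f : R -> R) :
  (forall t, a <= t <= b -> forall e : R, 0 < e ->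
     exists2 d : R, 0 < d & forall s, a <= s <= b -> `|s - t| < d -> `|f s - f t| < e) ->
  {within `[a, b], continuous (f : R^o -> R^o)}.
Proof.
move=> fP; apply/subspace_continuousP => t; rewrite /= in_itv /= => tab.
apply/cvgrPdist_lt => e e0; have [d d0 dP] := fP t tab e e0.
rewrite near_withinE; near=> s => /=; rewrite in_itv /= => sab.
rewrite distrC; apply: dP => //; rewrite distrC; near: s.
Unshelve. all: by end_near. Qed.

Lemma integrable_ReIm a b k : cont_itv a b k ->
  (@lebesgue_measure R).-integrable `[a, b] (EFin \o (fun x => complex.Re (k x))) /\
  (@lebesgue_measure R).-integrable `[a, b] (EFin \o (fun x => complex.Im (k x))).
Proof.
move=> ck; split; apply: continuous_compact_integrable;
  [exact: segment_compact| |exact: segment_compact|];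
  apply: within_continuous_itv => t tab e e0;
  have [d d0 dP] := ck _ tab _ e0; exists d => // s sab std;
  apply: le_lt_trans (dP s sab std) => /=.
- by rewrite -ReB Re_rn.
- by rewrite -ImB Im_rn.
Qed.

Lemma cont_itv_sub a b a' b' k : a <= a' -> b' <= b -> cont_itv a b k -> cont_itv a' b' k.
Proof.
move=> aa bb ck t /andP[t1 t2] e e0.
have [|d d0 dP] := ck t _ e e0; first by rewrite (le_trans aa t1) (le_trans t2 bb).
exists d => // s /andP[s1 s2]; apply: dP.
by rewrite (le_trans aa s1) (le_trans s2 bb).
Qed.

Lemma cint_split a b c k : a <= c <= b -> cont_itv a b k ->
  cint a b k = cint a c k + cint c b k.
Proof.
move=> /andP[ac cb] ck; have [iR iI] := integrable_ReIm ck.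
have [iR' iI'] := integrable_ReIm (cont_itv_sub ac (lexx b) ck).
have key (f : R -> R) : (@lebesgue_measure R).-integrable `[a, b] (EFin \o f) ->
    (@lebesgue_measure R).-integrable `[c, b] (EFin \o f) ->
  \int[@lebesgue_measure R]_(x in `[a, b]) f x =
  \int[@lebesgue_measure R]_(x in `[a, c]) f x +
  \int[@lebesgue_measure R]_(x in `[c, b]) f x.
  move=> fi fi'; rewrite -(@Rintegral_itv_obnd_cbnd _ c).
    by rewrite -(Rintegral_itvB fi)// 1?addrC ?subrK// bnd_simp.
  by apply: integrableS fi' => //; apply: subset_itvr; rewrite bnd_simp.
by apply/eqP; rewrite eq_complex /=; apply/andP; split; apply/eqP; exact: key.
Qed.

Lemma eq_cint a b k1 k2 : (forall x, a <= x <= b -> k1 x = k2 x) ->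
  cint a b k1 = cint a b k2.
Proof.
move=> k12; congr Complex; apply: eq_Rintegral => x;
  by rewrite inE /= in_itv /= => xab; rewrite k12.
Qed.

Lemma cintB a b k1 k2 : cont_itv a b k1 -> cont_itv a b k2 ->
  cint a b (fun x => k1 x - k2 x) = cint a b k1 - cint a b k2.
Proof.
move=> /integrable_ReIm[r1 i1] /integrable_ReIm[r2 i2].
apply/eqP; rewrite eq_complex /=; apply/andP; split; apply/eqP.
- rewrite -RintegralB//; apply: eq_Rintegral => x _; exact: ReB.
- rewrite -RintegralB//; apply: eq_Rintegral => x _; exact: ImB.
Qed.

Lemma cintZ a b (u : R[i]) k : cont_itv a b k ->
  cint a b (fun x => u * k x) = u * cint a b k.
Proof.
move=> /integrable_ReIm[r1 i1]; case: u => p q.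
have iZ f s : (@lebesgue_measure R).-integrable `[a, b] (EFin \o f) ->
   (@lebesgue_measure R).-integrable `[a, b] (EFin \o (fun x => s * f x)).
  by move=> fi; apply: (integrableZl _ s fi).
apply/eqP; rewrite eq_complex /=; apply/andP; split; apply/eqP.
- rewrite -!RintegralZl// -RintegralB//; [|exact: iZ|exact: iZ].
  by apply: eq_Rintegral => x _; case: (k x).
- rewrite -!RintegralZl// -RintegralD//; [|exact: iZ|exact: iZ].
  by apply: eq_Rintegral => x _; case: (k x).
Qed.

Lemma Rint_bound a b (f : R -> R) (B : R) : a <= b ->
  (@lebesgue_measure R).-integrable `[a, b] (EFin \o f) ->
  (forall x, a <= x <= b -> `|f x| <= B) ->
  `|\int[@lebesgue_measure R]_(x in `[a, b]) f x| <= B * (b - a).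
Proof.
move=> ab fi fB; apply: le_trans (le_normr_Rintegral _ fi) _ => //.
have -> : B * (b - a) = \int[@lebesgue_measure R]_(x in `[a, b]) B.
  rewrite Rintegral_cst//; have := lebesgue_measure_itv `[a, b] => /=.
  rewrite /fine => ->; rewrite lte_fin /=.
  by case: ltgtP ab => // -> _; rewrite subrr.
apply: le_Rintegral => //.
- exact: integrable_norm.
- apply: continuous_compact_integrable; first exact: segment_compact.
  by apply: continuous_subspaceT => x; exact: cvg_cst.
Qed.

(** The factor 2 comes from bounding the real and the imaginary integral separately. *)
Lemma cint_bound a b k (B : R) : a <= b -> cont_itv a b k ->
  (forall x, a <= x <= b -> rn (k x) <= B) -> rn (cint a b k) <= 2 * B * (b - a).
Proof.
move=> ab /integrable_ReIm[r1 i1] kB.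
apply: le_trans (rn_ReIm _) _; rewrite mulrDl mulrDl mul1r; apply: lerD => /=.
- apply: Rint_bound => // x /kB; apply: le_trans; exact: Re_rn.
- apply: Rint_bound => // x /kB; apply: le_trans; exact: Im_rn.
Qed.

Lemma Rint_affine a b (u v : R) : a <= b ->
  \int[@lebesgue_measure R]_(x in `[a, b]) (u + x * v) =
  (b - a) * u + (b ^+ 2 - a ^+ 2) / 2 * v.
Proof.
rewrite le_eqVlt => /predU1P[->|ab].
  by rewrite set_itv1 Rintegral_set1 !subrr !mul0r addr0.
pose F x := x * u + x ^+ 2 / 2 * v.
have dF x : is_derive x (1 : R) F (u + x * v).
  rewrite /F; apply: is_derive_eq; rewrite /GRing.scale /=. lra.
have cf : {within `[a, b], continuous (fun x => u + x * v : R^o)}.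
  apply: continuous_subspaceT => x; apply: cvgD; first exact: cvg_cst.
  by apply: cvgM; [exact: cvg_id|exact: cvg_cst].
rewrite /Rintegral (@continuous_FTC2 _ _ F)//.
- by rewrite /F -EFinB /=; lra.
- have cF : continuous (F : R -> R).
    by move=> x; apply/differentiable_continuous/derivable1_diffP; case: (dF x).
  split=> [x _| |]; first by case: (dF x).
  + by apply: cvg_at_right_filter; exact: cF.
  + by apply: cvg_at_left_filter; exact: cF.
- by move=> x _; rewrite derive1E derive_val.
Qed.

Lemma cint_affine a b (u v : R[i]) : a <= b ->
  cint a b (fun x => u + x%:C * v) = (b - a)%:C * u + ((b ^+ 2 - a ^+ 2) / 2)%:C * v.
Proof.
case: u => p q; case: v => p' q' ab.
apply/eqP; rewrite eq_complex /=; apply/andP; split; apply/eqP.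
- rewrite !mul0r !subr0 -Rint_affine//.
  by apply: eq_Rintegral => x _ /=; rewrite subr0.
- rewrite !mul0r !addr0 -Rint_affine//.
  by apply: eq_Rintegral => x _ /=; rewrite addr0.
Qed.

End LineIntegral.

(** * Goursat's theorem on rectangles *)

Section Goursat.
Variable R : realType.
Implicit Types (a b c d : R) (f : R[i] -> R[i]) (z l : R[i]).

(** Existence of the derivative at one point, without continuity of the derivative: the assumption
    under which Goursat's argument works. *)
Definition has_cderiv f z l := forall e : R, 0 < e -> exists2 d : R, 0 < d &
  forall w : R[i], rn w < d -> rn (f (z + w) - f z - l * w) <= e * rn w.

Definition rect a b c d : set R[i] :=
  [set z | a <= complex.Re z <= b /\ c <= complex.Im z <= d].

(* The contour integral along the boundary of the rectangle. *)
Definition rint f a b c d : R[i] :=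
  cint a b (fun x => f (Complex x c)) + 'i * cint c d (fun y => f (Complex b y))
  - cint a b (fun x => f (Complex x d)) - 'i * cint c d (fun y => f (Complex a y)).

Lemma has_cderiv_cont f z l : has_cderiv f z l -> forall e : R, 0 < e ->
  exists2 d : R, 0 < d & forall w, rn w < d -> rn (f (z + w) - f z) < e.
Proof.
move=> fz e e0; have [d d0 dP] := fz 1 ltr01.
have l1 : 0 < 1 + rn l by rewrite ltr_pwDl// rn_ge0.
exists (Num.min d (e / (1 + rn l))); first by rewrite lt_min d0 divr_gt0.
move=> w; rewrite lt_min => /andP[/dP wd]; rewrite ltr_pdivlMr// => we.
rewrite -[f (z + w) - f z](subrK (l * w)).
apply: le_lt_trans (rnD _ _) _; apply: le_lt_trans we.
by rewrite mulrDr mulr1 rnM [rn l * _]mulrC lerD2r mul1r in wd *.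
Qed.

Lemma cont_hline f a b y : (forall x, a <= x <= b -> exists l, has_cderiv f (Complex x y) l) ->
  cont_itv a b (fun x => f (Complex x y)).
Proof.
move=> fP t tab e e0; have [l /has_cderiv_cont/(_ e e0)[d d0 dP]] := fP t tab.
exists d => // s sab std; have := dP (s - t)%:C; rewrite rn_real => /(_ std).
suff -> : Complex t y + (s - t)%:C = Complex s y by [].
by apply/eqP; rewrite eq_complex /= addr0 addrC subrK !eqxx.
Qed.

Lemma cont_vline f c d x : (forall y, c <= y <= d -> exists l, has_cderiv f (Complex x y) l) ->
  cont_itv c d (fun y => f (Complex x y)).
Proof.
move=> fP t tab e e0; have [l /has_cderiv_cont/(_ e e0)[r r0 rP]] := fP t tab.
exists r => // s sab std; have := rP ('i * (s - t)%:C); rewrite rnM rn_i mul1r rn_real => /(_ std).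
suff -> : Complex x t + 'i * (s - t)%:C = Complex x s by [].
apply/eqP; rewrite eq_complex /=; apply/andP; split; apply/eqP; ring.
Qed.

Definition cont_bdry f a b c d :=
  [/\ cont_itv a b (fun x => f (Complex x c)), cont_itv c d (fun y => f (Complex b y)),
      cont_itv a b (fun x => f (Complex x d)) & cont_itv c d (fun y => f (Complex a y))].

Definition bdry a b c d : set R[i] := [set z | rect a b c d z /\
  [\/ complex.Re z = a, complex.Re z = b, complex.Im z = c | complex.Im z = d]].

Lemma has_cderiv_bdry f a b c d : a <= b -> c <= d ->
  (forall z, bdry a b c d z -> exists l, has_cderiv f z l) -> cont_bdry f a b c d.
Proof.
move=> ab cd fP; split; (apply: cont_hline || apply: cont_vline) => x xP; apply: fP;
  rewrite /bdry /rect /= ?lexx ?ab ?cd xP; split=> //.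
- exact: Or43.
- exact: Or42.
- exact: Or44.
- exact: Or41.
Qed.

Lemma rintB f g a b c d : cont_bdry f a b c d -> cont_bdry g a b c d ->
  rint (fun z => f z - g z) a b c d = rint f a b c d - rint g a b c d.
Proof.
move=> [f1 f2 f3 f4] [g1 g2 g3 g4]; rewrite /rint !cintB//; ring.
Qed.

Lemma rintZ f u a b c d : cont_bdry f a b c d ->
  rint (fun z => u * f z) a b c d = u * rint f a b c d.
Proof.
move=> [f1 f2 f3 f4]; rewrite /rint !cintZ//; ring.
Qed.

Lemma rint_affine u l a b c d : a <= b -> c <= d ->
  rint (fun z => u + l * z) a b c d = 0.
Proof.
move=> ab cd; rewrite /rint.
have hE y : cint a b (fun x => u + l * Complex x y) =
   (b - a)%:C * (u + l * ('i * y%:C)) + ((b ^+ 2 - a ^+ 2) / 2)%:C * l.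
  rewrite -cint_affine//; apply: eq_cint => x _.
  have -> : Complex x y = x%:C + 'i * y%:C by rewrite [LHS]complexE.
  ring.
have vE x : cint c d (fun y => u + l * Complex x y) =
   (d - c)%:C * (u + l * x%:C) + ((d ^+ 2 - c ^+ 2) / 2)%:C * ('i * l).
  rewrite -cint_affine//; apply: eq_cint => y _.
  have -> : Complex x y = x%:C + 'i * y%:C by rewrite [LHS]complexE.
  ring.
rewrite !hE !vE.
have i2 : 'i * 'i = -1 :> R[i] by rewrite -expr2 sqr_i.
have -> : ((d ^+ 2 - c ^+ 2) / 2)%:C * ('i * l) = 'i * (((d ^+ 2 - c ^+ 2) / 2)%:C * l) by ring.
rewrite !rmorphB /=; ring.
Qed.

Lemma rint_bound f a b c d (B : R) : a <= b -> c <= d -> cont_bdry f a b c d ->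
  (forall z, bdry a b c d z -> rn (f z) <= B) ->
  rn (rint f a b c d) <= 4 * B * ((b - a) + (d - c)).
Proof.
move=> ab cd [f1 f2 f3 f4] fB.
have hB y : c <= y <= d -> y = c \/ y = d -> cont_itv a b (fun x => f (Complex x y)) ->
    rn (cint a b (fun x => f (Complex x y))) <= 2 * B * (b - a).
  move=> ycd yE ck; apply: cint_bound => // x xab; apply: fB; split=> //=.
  by case: yE => ->; [exact: Or43|exact: Or44].
have vB x : a <= x <= b -> x = a \/ x = b -> cont_itv c d (fun y => f (Complex x y)) ->
    rn (cint c d (fun y => f (Complex x y))) <= 2 * B * (d - c).
  move=> ycd xE ck; apply: cint_bound => // y xab; apply: fB; split=> //=.
  by case: xE => ->; [exact: Or41|exact: Or42].
have := hB c; rewrite lexx cd => /(_ isT (or_introl erefl) f1) h1.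
have := hB d; rewrite lexx cd => /(_ isT (or_intror erefl) f3) h2.
have := vB a; rewrite lexx ab => /(_ isT (or_introl erefl) f4) h3.
have := vB b; rewrite lexx ab => /(_ isT (or_intror erefl) f2) h4.
rewrite /rint; apply: le_trans (rnB _ _) _; rewrite rnM rn_i mul1r.
have := rnB (cint a b (fun x => f (Complex x c)) + 'i * cint c d (fun y => f (Complex b y)))
  (cint a b (fun x => f (Complex x d))).
have := rnD (cint a b (fun x => f (Complex x c))) ('i * cint c d (fun y => f (Complex b y))).
rewrite rnM rn_i mul1r; nra.
Qed.

Lemma rint_hsplit f a m b c d : a <= m <= b -> cont_bdry f a b c d ->
  rint f a b c d = rint f a m c d + rint f m b c d.
Proof.
move=> amb [f1 f2 f3 f4]; rewrite /rint (cint_split amb f1) (cint_split amb f3); ring.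
Qed.

Lemma rint_vsplit f a b c m d : c <= m <= d -> cont_bdry f a b c d ->
  rint f a b c d = rint f a b c m + rint f a b m d.
Proof.
move=> amb [f1 f2 f3 f4]; rewrite /rint (cint_split amb f2) (cint_split amb f4); ring.
Qed.

Lemma nested_itv (a b : nat -> R) : (forall k, a k <= a k.+1) -> (forall k, b k.+1 <= b k) ->
  (forall k, a k <= b k) -> exists p, forall k, a k <= p <= b k.
Proof.
move=> ai bd ab.
have amono : {homo a : k l / (k <= l)%N >-> k <= l} by apply: homo_leq => // ? ? ?; exact: le_trans.
have bmono : {homo b : k l / (k <= l)%N >-> l <= k}.
  by apply: (@homo_leq _ _ (fun x y => y <= x)) => // y x z xy yz; exact: le_trans yz xy.
have ubA (l : nat) : ubound (range a) (b l).
  move=> _ [k _ <-]; apply: le_trans (amono _ _ (leq_maxl k l)) _.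
  by apply: le_trans (ab _) _; apply: bmono; exact: leq_maxr.
exists (sup (range a)) => k; apply/andP; split.
  by apply: ub_le_sup; [exists (b 0); exact: ubA|exists k].
by apply: ge_sup; [exists (a 0); exists 0%N|exact: ubA].
Qed.

(* Goursat's bisection: one of the four quarters keeps at least a quarter of the
   contour integral. *)
Lemma rint_quarter f a b c d (t : R) : a <= b -> c <= d ->
  (forall z, rect a b c d z -> exists l, has_cderiv f z l) ->
  t < rn (rint f a b c d) ->
  exists Q : R * R * (R * R),
  [/\ [/\ a <= Q.1.1, Q.1.2 <= b, c <= Q.2.1 & Q.2.2 <= d],
      Q.1.2 - Q.1.1 = (b - a) / 2, Q.2.2 - Q.2.1 = (d - c) / 2 &
      t / 4 < rn (rint f Q.1.1 Q.1.2 Q.2.1 Q.2.2)].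
Proof.
move=> ab cd fP hJ; pose m := (a + b) / 2; pose p := (c + d) / 2.
have [am mb] : a <= m /\ m <= b by rewrite /m; split; lra.
have [cp pd] : c <= p /\ p <= d by rewrite /p; split; lra.
have [w1 w2] : m - a = (b - a) / 2 /\ b - m = (b - a) / 2 by rewrite /m; split; field.
have [w3 w4] : p - c = (d - c) / 2 /\ d - p = (d - c) / 2 by rewrite /p; split; field.
have bd x y u v : a <= x -> y <= b -> c <= u -> v <= d -> x <= y -> u <= v ->
    cont_bdry f x y u v.
  move=> h1 h2 h3 h4 h5 h6; apply: has_cderiv_bdry => // z [[/andP[z1 z2] /andP[z3 z4]] _].
  by apply: fP; rewrite /rect /= (le_trans h1 z1) (le_trans z2 h2) (le_trans h3 z3) (le_trans z4 h4).
have JE : rint f a b c d = rint f a m c p + rint f a m p d + (rint f m b c p + rint f m b p d).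
  rewrite (@rint_hsplit f a m)/=; [|by rewrite am mb|by apply: bd].
  rewrite (@rint_vsplit f a m c p)/=; [|by rewrite cp pd|by apply: bd].
  by rewrite (@rint_vsplit f m b c p)/=; [|by rewrite cp pd|by apply: bd].
apply: contrapT => H.
have G x y u v : a <= x -> y <= b -> c <= u -> v <= d ->
    y - x = (b - a) / 2 -> v - u = (d - c) / 2 -> rn (rint f x y u v) <= t / 4.
  move=> h1 h2 h3 h4 h5 h6; rewrite leNgt; apply/negP => hh; apply: H.
  by exists ((x, y), (u, v)).
have k1 := G a m c p (lexx _) mb (lexx _) pd w1 w3.
have k2 := G a m p d (lexx _) mb cp (lexx _) w1 w4.
have k3 := G m b c p am (lexx _) (lexx _) pd w2 w3.
have k4 := G m b p d am (lexx _) cp (lexx _) w2 w4.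
have := rnD (rint f a m c p + rint f a m p d) (rint f m b c p + rint f m b p d).
have := rnD (rint f a m c p) (rint f a m p d).
have := rnD (rint f m b c p) (rint f m b p d).
move=> h1 h2 h3; move: hJ; apply/negP; rewrite -leNgt JE.
rewrite [leRHS](_ : t = (t / 4 + t / 4) + (t / 4 + t / 4)); last by field.
apply: le_trans h3 (lerD (le_trans h2 (lerD k1 k2)) (le_trans h1 (lerD k3 k4))).
Qed.

Lemma cont_itvB a b (k1 k2 : R -> R[i]) : cont_itv a b k1 -> cont_itv a b k2 ->
  cont_itv a b (fun t => k1 t - k2 t).
Proof.
move=> h1 h2 t ht e e0; have e2 : 0 < e / 2 by rewrite divr_gt0.
have [r1 r10 r1P] := h1 t ht _ e2; have [r2 r20 r2P] := h2 t ht _ e2.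
exists (Num.min r1 r2); first by rewrite lt_min r10.
move=> s hs; rewrite lt_min => /andP[/(r1P _ hs) w1 /(r2P _ hs) w2].
have -> : k1 s - k2 s - (k1 t - k2 t) = (k1 s - k1 t) - (k2 s - k2 t) by ring.
by apply: le_lt_trans (rnB _ _) _; lra.
Qed.

Lemma cont_bdryB f g a b c d : cont_bdry f a b c d -> cont_bdry g a b c d ->
  cont_bdry (fun z => f z - g z) a b c d.
Proof. by move=> [? ? ? ?] [? ? ? ?]; split; apply: cont_itvB. Qed.

Lemma has_cderiv_affine u l z : has_cderiv (fun z => u + l * z) z l.
Proof.
move=> e e0; exists 1 => // w _.
have -> : u + l * (z + w) - (u + l * z) - l * w = 0 by ring.
by rewrite rn0 mulr_ge0 ?rn_ge0// ltW.
Qed.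

(** The affine part of f at p integrates to 0, and the remainder is at most (e / 8) (w + h) on a
    rectangle of sides w and h. With [rint_bound] the integral is at most (e / 2) (w + h)^2, and (w
    + h)^2 <= 2 (w^2 + h^2). *)
Lemma rint_local f p l (e : R) : has_cderiv f p l -> 0 < e ->
  exists2 r : R, 0 < r & forall a b c d, a <= b -> c <= d -> rect a b c d p ->
  (b - a) + (d - c) < r ->
  (forall z, rect a b c d z -> exists l, has_cderiv f z l) ->
  rn (rint f a b c d) <= e * ((b - a) ^+ 2 + (d - c) ^+ 2).
Proof.
move=> fp e0; have e8 : 0 < e / 8 by rewrite divr_gt0.
have [r r0 rP] := fp _ e8; exists r => // a b c d ab cd [/andP[p1 p2] /andP[p3 p4]] sr fl.
pose A z := (f p - l * p) + l * z.
have bf : cont_bdry f a b c d by apply: has_cderiv_bdry => // z [/fl].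
have bA : cont_bdry A a b c d.
  by apply: has_cderiv_bdry => // z _; exists l; exact: has_cderiv_affine.
have JE : rint f a b c d = rint (fun z => f z - A z) a b c d.
  by rewrite rintB// rint_affine// subr0.
pose s := (b - a) + (d - c).
have bound z : bdry a b c d z -> rn (f z - A z) <= e / 8 * s.
  move=> [[/andP[z1 z2] /andP[z3 z4]] _].
  have zp : rn (z - p) <= s.
    apply: le_trans (rn_ReIm _) _; rewrite ReB ImB /=.
    apply: lerD; rewrite ler_norml; apply/andP; split.
    - by clear -z1 p2; lra.
    - by clear -z2 p1; lra.
    - by clear -z3 p4; lra.
    - by clear -z4 p3; lra.
  have := rP (z - p); rewrite [p + _]addrC subrK (le_lt_trans zp sr) => /(_ isT).
  have -> : f z - f p - l * (z - p) = f z - A z by rewrite /A; ring.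
  by move=> h; apply: le_trans h _; rewrite ler_wpM2l// ltW//.
have := rint_bound ab cd (cont_bdryB bf bA) bound; rewrite -JE.
move=> h; apply: le_trans h _; rewrite /s.
have : 0 <= e * ((b - a) - (d - c)) ^+ 2 by rewrite mulr_ge0 ?sqr_ge0// ltW.
clear; nra.
Qed.

Lemma goursat f a b c d : a <= b -> c <= d ->
  (forall z, rect a b c d z -> exists l, has_cderiv f z l) -> rint f a b c d = 0.
Proof.
move=> ab cd fP; apply: rn_eq0; apply/eqP; rewrite eq_le rn_ge0 andbT.
(* Bisection divides [mu] by 4, as it does the lower bound of [rint_quarter], so an inequality e *
   mu Q < rn (J Q) is inherited by some quarter. At the common point of the nested rectangles it
   contradicts [rint_local]. *)
pose mu (Q : R * R * (R * R)) := (Q.1.2 - Q.1.1) ^+ 2 + (Q.2.2 - Q.2.1) ^+ 2.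
pose J (Q : R * R * (R * R)) := rint f Q.1.1 Q.1.2 Q.2.1 Q.2.2.
pose Q0 := ((a, b), (c, d)).
have mu0 Q : 0 <= mu Q by rewrite /mu addr_ge0 ?sqr_ge0.
suff H (e : R) : 0 < e -> rn (J Q0) <= e * mu Q0.
  rewrite leNgt; apply/negP => J0.
  (* Adding 1 covers the degenerate rectangle, where [mu] is 0. *)
  have m1 : 0 < mu Q0 + 1 by rewrite ltr_wpDl.
  have := H (rn (J Q0) / (mu Q0 + 1)); rewrite divr_gt0// => /(_ isT).
  rewrite mulrAC ler_pdivlMr// leNgt => /negP; apply.
  by rewrite ltr_pM2l// ltrDl.
move=> e0; rewrite leNgt; apply/negP => bad0.
pose bad Q := [/\ a <= Q.1.1, Q.1.2 <= b, c <= Q.2.1 & Q.2.2 <= d] /\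
  [/\ Q.1.1 <= Q.1.2, Q.2.1 <= Q.2.2 & e * mu Q < rn (J Q)].
pose sub (Q Q' : R * R * (R * R)) := [/\ Q.1.1 <= Q'.1.1, Q'.1.2 <= Q.1.2,
  Q.2.1 <= Q'.2.1 & Q'.2.2 <= Q.2.2] /\
  (Q'.1.2 - Q'.1.1 = (Q.1.2 - Q.1.1) / 2 /\ Q'.2.2 - Q'.2.1 = (Q.2.2 - Q.2.1) / 2).
have rectS Q : bad Q -> forall z, rect Q.1.1 Q.1.2 Q.2.1 Q.2.2 z -> rect a b c d z.
  move=> [[h1 h2 h3 h4] _] z [/andP[z1 z2] /andP[z3 z4]].
  by rewrite /rect /= (le_trans h1 z1) (le_trans z2 h2) (le_trans h3 z3) (le_trans z4 h4).
have step Q : bad Q -> exists Q', bad Q' /\ sub Q Q'.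
  move=> /[dup] bQ [[h1 h2 h3 h4] [h5 h6 h7]].
  have [Q' [[k1 k2 k3 k4] k5 k6 k7]] :=
    rint_quarter h5 h6 (fun z hz => fP z (rectS _ bQ z hz)) h7.
  exists Q'; split=> //; split.
    by rewrite (le_trans h1 k1) (le_trans k2 h2) (le_trans h3 k3) (le_trans k4 h4).
  split; [by rewrite -subr_ge0 k5 divr_ge0// subr_ge0|
          by rewrite -subr_ge0 k6 divr_ge0// subr_ge0|].
  suff -> : e * mu Q' = e * mu Q / 4 by [].
  by rewrite /mu k5 k6; field.
have [F FP] : exists F, forall Q, bad Q -> bad (F Q) /\ sub Q (F Q).
  have : forall Q, exists Q', bad Q -> bad Q' /\ sub Q Q'.
    move=> Q; have [/step[Q' HQ]|nb] := pselect (bad Q); first by exists Q'.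
    by exists Q.
  by move=> /choice[F FP]; exists F.
pose Q k := iter k F Q0.
have badQ k : bad (Q k).
  elim: k => [|k IH]; last by have [] := FP _ IH.
  by split => //; split.
have subQ k : sub (Q k) (Q k.+1) by have [] := FP _ (badQ k).
have [p1 p1P] : exists p, forall k, (Q k).1.1 <= p <= (Q k).1.2.
  apply: (@nested_itv (fun k => (Q k).1.1) (fun k => (Q k).1.2)) => k.
  - by have [[]] := subQ k.
  - by have [[]] := subQ k.
  - by have [_ []] := badQ k.
have [p2 p2P] : exists p, forall k, (Q k).2.1 <= p <= (Q k).2.2.
  apply: (@nested_itv (fun k => (Q k).2.1) (fun k => (Q k).2.2)) => k.
  - by have [[]] := subQ k.
  - by have [[]] := subQ k.
  - by have [_ []] := badQ k.
have width k : ((Q k).1.2 - (Q k).1.1) + ((Q k).2.2 - (Q k).2.1) =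
    ((b - a) + (d - c)) / 2 ^+ k.
  elim: k => [|k IH]; first by rewrite expr0 divr1.
  by have [_ [-> ->]] := subQ k; rewrite -mulrDl IH exprS invfM [_^-1 * _]mulrC mulrA.
pose p := Complex p1 p2.
have [l lP] : exists l, has_cderiv f p l by apply: fP; split; [exact: (p1P 0)|exact: (p2P 0)].
have [r r0 rP] := rint_local lP e0.
have [k kP] : exists k, ((b - a) + (d - c)) / 2 ^+ k < r.
  have w1 : 0 <= ((b - a) + (d - c)) by rewrite addr_ge0 // subr_ge0.
  have [k kP] : exists k : nat, ((b - a) + (d - c)) / r < k%:R.
    by exists (Num.bound (((b - a) + (d - c)) / r)); rewrite archi_boundP// divr_ge0// ltW.
  exists k; rewrite ltr_pdivrMr ?exprn_gt0// mulrC -ltr_pdivrMr//.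
  apply: lt_trans kP _; rewrite -natrX ltr_nat; exact: ltn_expl.
have [_ [q5 q6 q7]] := badQ k.
have := rP _ _ _ _ q5 q6; rewrite width kP => H.
have : rn (J (Q k)) <= e * mu (Q k).
  by apply: H => // z /(rectS _ (badQ k)) /fP.
by rewrite leNgt q7.
Qed.

End Goursat.

(** * Cauchy's estimate for the derivative at the centre of a disc *)

Section CauchyEstimate.
Variable R : realType.
Implicit Types (a b c d r s : R) (f : R[i] -> R[i]) (z l : R[i]).

Lemma has_cderivP f z : differentiable f z -> has_cderiv f z ('d f z 1).
Proof.
move=> fz e e0; have [d d0 dP] := diff_rn fz e0; exists d => // w wd.
suff -> : 'd f z 1 * w = 'd f z w by exact: dP.
have : 'd f z (w *: 1) = w *: 'd f z 1 by rewrite linearZ.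
by rewrite /GRing.scale /= mulr1 mulrC.
Qed.

Lemma has_cderiv_diff f z l : has_cderiv f z l -> differentiable f z.
Proof.
move=> fz; have := @rn_differentiable R R[i] R[i] f (fun w => l * w) z (rn l).
case=> //.
- by move=> u v w; rewrite mulrDr; congr (_ + _); rewrite /GRing.scale /=; ring.
- by move=> v; rewrite rnM.
Qed.

Lemma Rint_ge a b (f : R -> R) (B : R) : a <= b ->
  (@lebesgue_measure R).-integrable `[a, b] (EFin \o f) ->
  (forall x, a <= x <= b -> B <= f x) ->
  B * (b - a) <= \int[@lebesgue_measure R]_(x in `[a, b]) f x.
Proof.
move=> ab fi fB.
have -> : B * (b - a) = \int[@lebesgue_measure R]_(x in `[a, b]) B.
  rewrite Rintegral_cst//; have := lebesgue_measure_itv `[a, b] => /=.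
  rewrite /fine => ->; rewrite lte_fin /=.
  by case: ltgtP ab => // -> _; rewrite subrr.
apply: le_Rintegral => //.
apply: continuous_compact_integrable; first exact: segment_compact.
by apply: continuous_subspaceT => x; exact: cvg_cst.
Qed.

Lemma bdry_ge r z : 0 < r -> bdry (- r) r (- r) r z -> r <= rn z.
Proof.
move=> r0 [_ []] zE; [apply: le_trans (Re_rn z)|apply: le_trans (Re_rn z)|
  apply: le_trans (Im_rn z)|apply: le_trans (Im_rn z)];
  by rewrite zE ?normrN gtr0_norm.
Qed.

Lemma bdry_neq0 r z : 0 < r -> bdry (- r) r (- r) r z -> z != 0.
Proof.
move=> r0 /(bdry_ge r0) rz; apply/eqP => z0; move: rz; rewrite z0 rn0; lra.
Qed.

Lemma cont_bdry_inv r : 0 < r -> cont_bdry (fun z => z^-1) (- r) r (- r) r.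
Proof.
move=> r0; have rr : - r <= r by lra.
apply: has_cderiv_bdry => // z /(bdry_neq0 r0) z0.
by exists ('d (fun z => z^-1) z 1); apply: has_cderivP; exact: differentiableV.
Qed.

(* The integral is 2 i pi; its imaginary part is at least 4 because the integrand
   contributes at least 1 on each side. *)
Lemma rint_inv_ge r : 0 < r -> 4 <= rn (rint (fun z => z^-1) (- r) r (- r) r).
Proof.
move=> r0; have rr : - r <= r by lra.
have [f1 f2 f3 f4] := cont_bdry_inv r0.
have key t : - r <= t <= r -> 1 / (2 * r) <= r / (t ^+ 2 + r ^+ 2).
  move=> /andP[t1 t2].
  have tr : 0 < t ^+ 2 + r ^+ 2 by rewrite ltr_wpDl ?sqr_ge0 ?exprn_gt0.
  by rewrite ler_pdivlMr// mulrAC ler_pdivrMr ?mulr_gt0//; nra.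
have e1 : 1 = 1 / (2 * r) * (r - - r) by field; rewrite gt_eqF.
apply: le_trans (Im_rn _); apply: le_trans (ler_norm _).
have [_ i1] := integrable_ReIm f1; have [i2 _] := integrable_ReIm f2.
have [_ i3] := integrable_ReIm f3; have [i4 _] := integrable_ReIm f4.
have h1 : 1 <= \int[@lebesgue_measure R]_(x in `[- r, r]) complex.Im (Complex x (- r))^-1.
  rewrite {1}e1; apply: Rint_ge => // x /key.
  by rewrite /= sqrrN mulNr opprK.
have h2 : 1 <= \int[@lebesgue_measure R]_(x in `[- r, r]) complex.Re (Complex r x)^-1.
  rewrite {1}e1; apply: Rint_ge => // x /key.
  by rewrite /= [r ^+ 2 + _]addrC.
have h3 : \int[@lebesgue_measure R]_(x in `[- r, r]) complex.Im (Complex x r)^-1 <= - 1.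
  rewrite lerNr -[leRHS]mulN1r -RintegralZl//.
  rewrite {1}e1; apply: Rint_ge => //; first exact: (integrableZl _ (-1) i3).
  by move=> x /key; rewrite /= mulN1r opprK.
have h4 : \int[@lebesgue_measure R]_(x in `[- r, r]) complex.Re (Complex (- r) x)^-1 <= - 1.
  rewrite lerNr -[leRHS]mulN1r -RintegralZl//.
  rewrite {1}e1; apply: Rint_ge => //; first exact: (integrableZl _ (-1) i4).
  by move=> x /key; rewrite /= sqrrN mulN1r mulNr opprK [r ^+ 2 + _]addrC.
rewrite /rint /cint !ImB /=; lra.
Qed.


(** Cutting off the left and right strips, then the bottom and top pieces, leaves the small square;
    the four pieces removed avoid 0, so their integrals vanish by [goursat]. *)
Lemma rint_annulus f r s : 0 < r -> r <= s ->
  (forall z, rect (- s) s (- s) s z -> z != 0 -> exists l, has_cderiv f z l) ->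
  rint f (- s) s (- s) s = rint f (- r) r (- r) r.
Proof.
move=> r0 rs fP.
have fP' a b c d z : - s <= a -> b <= s -> - s <= c -> d <= s -> rect a b c d z -> z != 0 ->
    exists l, has_cderiv f z l.
  move=> h1 h2 h3 h4 [/andP[z1 z2] /andP[z3 z4]]; apply: fP.
  by rewrite /rect /= (le_trans h1 z1) (le_trans z2 h2) (le_trans h3 z3) (le_trans z4 h4).
have ss : - s <= s by lra.
have sr : - s <= - r by lra.
have rs' : - r <= s by lra.
have rs2 : - s <= r by lra.
have rr : - r <= r by lra.
have neq z t : 0 < `|t| -> complex.Re z = t \/ complex.Im z = t -> z != 0.
  by move=> t0 zE; apply/eqP => z0; move: zE t0; rewrite z0 /= => -[] <-; rewrite normr0 ltxx.
have nr : 0 < `|r| by rewrite gtr0_norm.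
have nr' : 0 < `|- r| by rewrite normrN gtr0_norm.
have ns : 0 < `|s| by rewrite gtr0_norm// (lt_le_trans r0).
have ns' : 0 < `|- s| by rewrite normrN.
(* The nonzero side coordinates keep the boundary away from 0, where f need not have a
   derivative. *)
have cb a b c d : a <= b -> c <= d -> - s <= a -> b <= s -> - s <= c -> d <= s ->
    0 < `|a| -> 0 < `|b| -> 0 < `|c| -> 0 < `|d| -> cont_bdry f a b c d.
  move=> ab cd h1 h2 h3 h4 n1 n2 n3 n4; apply: has_cderiv_bdry => // z [zr zE].
  apply: fP' zr _ => //; case: zE => zE.
  - by apply: (neq _ a) => //; left.
  - by apply: (neq _ b) => //; left.
  - by apply: (neq _ c) => //; right.
  - by apply: (neq _ d) => //; right.
have g0 a b c d : a <= b -> c <= d -> - s <= a -> b <= s -> - s <= c -> d <= s ->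
    (forall z, rect a b c d z -> z != 0) -> rint f a b c d = 0.
  move=> ab cd h1 h2 h3 h4 z0; apply: goursat => // z zr.
  by apply: fP' (zr) _ => //; exact: z0 zr.
have npos z : 0 < `|complex.Re z| \/ 0 < `|complex.Im z| -> z != 0.
  by move=> zE; apply/eqP => z0; move: zE; rewrite z0 /= normr0 ltxx => -[].
rewrite (@rint_hsplit _ f (- s) (- r) s); [|by rewrite sr rs'|by apply: cb].
rewrite (g0 (- s) (- r)) ?add0r//; last first.
  move=> z [/andP[_ z2] _]; apply: npos; left; rewrite normr_gt0; apply/eqP; lra.
rewrite (@rint_hsplit _ f (- r) r s); [|by rewrite rr rs|by apply: cb].
rewrite (g0 r s) ?addr0//; last first.
  move=> z [/andP[z2 _] _]; apply: npos; left; rewrite normr_gt0; apply/eqP; lra.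
rewrite (@rint_vsplit _ f _ _ (- s) (- r) s); [|by rewrite sr rs'|by apply: cb].
rewrite (g0 _ _ (- s) (- r)) ?add0r//; last first.
  move=> z [_ /andP[_ z2]]; apply: npos; right; rewrite normr_gt0; apply/eqP; lra.
rewrite (@rint_vsplit _ f _ _ (- r) r s); [|by rewrite rr rs|by apply: cb].
rewrite (g0 _ _ r s) ?addr0//.
move=> z [_ /andP[z2 _]]; apply: npos; right; rewrite normr_gt0; apply/eqP; lra.
Qed.

(* q(z) = (f(z) - f(0)) / z^2 has the same integral along the squares of half-side
   s and r < s, and q(z) - f'(0) / z is o(1 / |z|) at 0. *)
Lemma cauchy_estimate f l (s0 B : R) : 0 < s0 -> has_cderiv f 0 l ->
  (forall z, rn z < s0 -> exists l, has_cderiv f z l) ->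
  (forall z, rn z < s0 -> rn (f z) <= B) -> rn l <= 24 * B / s0.
Proof.
(* On the square of half-side s0 / 3, |Re z| + |Im z| <= 2 s0 / 3, so it lies in the disc of radius
   s0. *)
move=> s00 f0 fD fB; pose s := s0 / 3.
have s_gt0 : 0 < s by rewrite divr_gt0.
have ss : - s <= s by lra.
have sz z : rect (- s) s (- s) s z -> rn z < s0.
  move=> [z1 z2]; apply: le_lt_trans (rn_ReIm _) _.
  have : `|complex.Re z| <= s by rewrite ler_norml.
  have : `|complex.Im z| <= s by rewrite ler_norml.
  by rewrite /s; lra.
pose q z := (f z - f 0) * (z ^+ 2)^-1.
have qD z : rect (- s) s (- s) s z -> z != 0 -> exists l, has_cderiv q z l.
  move=> /sz /fD [l' /has_cderiv_diff fz] z0; exists ('d q z 1); apply: has_cderivP.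
  apply: differentiableM; first exact: differentiableB.
  by apply: differentiableV => //; rewrite expf_eq0 /= z0.
have qs : rn (rint q (- s) s (- s) s) <= 32 * B / s.
  have -> : 32 * B / s = 4 * (2 * B / s ^+ 2) * ((s - - s) + (s - - s)).
    by field; rewrite gt_eqF.
  apply: rint_bound => //.
    apply: has_cderiv_bdry => // z zb; apply: qD; first by case: zb.
    exact: bdry_neq0 zb.
  move=> z zb; have zs := bdry_ge s_gt0 zb; case: zb => /sz zs0 _.
  rewrite rnM rnV rnX; apply: ler_pM.
  - exact: rn_ge0.
  - by rewrite invr_ge0 exprn_ge0// rn_ge0.
  - rewrite mulr_natl mulr2n; apply: le_trans (rnB _ _) (lerD (fB _ zs0) (fB _ _)).
    by rewrite rn0.
  - by rewrite lef_pV2 ?posrE ?exprn_gt0 ?(lt_le_trans s_gt0 zs)// lerXn2r// nnegrE ?rn_ge0// ltW.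
(* The 4 is the lower bound for the integral of 1 / z; letting e tend to 0 gives 8 B / s, which is
   24 B / s0. *)
suff H (e : R) : 0 < e -> 4 * rn l <= 32 * B / s + 16 * e.
  have -> : 24 * B / s0 = 8 * B / s by rewrite /s; field; rewrite gt_eqF.
  rewrite leNgt; apply/negP => h.
  have := H ((rn l - 8 * B / s) / 8); rewrite divr_gt0 ?subr_gt0// => /(_ isT).
  by rewrite -!mulrA in h *; lra.
move=> e0; have [d d0 dP] := f0 _ e0.
pose r := Num.min s (d / 3).
have r0 : 0 < r by rewrite lt_min s_gt0 divr_gt0.
have rs : r <= s by rewrite /r ge_min lexx.
have rd : r <= d / 3 by rewrite /r ge_min lexx orbT.
have rr : - r <= r by lra.
have bq : cont_bdry q (- r) r (- r) r.
  apply: has_cderiv_bdry => // z zb; apply: qD; last exact: bdry_neq0 zb.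
  case: zb => -[/andP[z1 z2] /andP[z3 z4]] _; split; apply/andP; split; lra.
have bi := cont_bdry_inv r0.
have bli : cont_bdry (fun z => l * z^-1) (- r) r (- r) r.
  apply: has_cderiv_bdry => // z /(bdry_neq0 r0) z0.
  exists ('d (fun z => l * z^-1) z 1); apply: has_cderivP.
  by apply: differentiableM; [exact: differentiable_cst|exact: differentiableV].
have qr : rn (rint q (- r) r (- r) r - l * rint (fun z => z^-1) (- r) r (- r) r) <= 16 * e.
  rewrite -(rintZ l bi) -rintB//.
  have -> : 16 * e = 4 * (e / r) * ((r - - r) + (r - - r)) by field; rewrite gt_eqF.
  apply: rint_bound => //; first exact: cont_bdryB.
  move=> z zb; have z0 := bdry_neq0 r0 zb; have rz := bdry_ge r0 zb.
  have zd : rn z < d.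
    case: zb => -[z1 z2] _; apply: le_lt_trans (rn_ReIm _) _.
    have : `|complex.Re z| <= r by rewrite ler_norml.
    have : `|complex.Im z| <= r by rewrite ler_norml.
    lra.
  have -> : q z - l * z^-1 = (f (0 + z) - f 0 - l * z) * (z ^+ 2)^-1.
    by rewrite add0r /q; field.
  rewrite rnM rnV rnX; apply: le_trans (_ : e * rn z * (rn z ^+ 2)^-1 <= _).
    by rewrite ler_wpM2r ?invr_ge0 ?exprn_ge0 ?rn_ge0//; exact: dP.
  have rz0 : 0 < rn z by exact: lt_le_trans rz.
  have -> : e * rn z * (rn z ^+ 2)^-1 = e / rn z by field; rewrite gt_eqF.
  by rewrite ler_wpM2l ?(ltW e0)// lef_pV2.
have li : 4 * rn l <= rn (l * rint (fun z => z^-1) (- r) r (- r) r).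
  by rewrite rnM mulrC ler_wpM2l ?rn_ge0//; exact: rint_inv_ge.
apply: le_trans li _.
rewrite -[X in rn X](subKr (rint q (- r) r (- r) r)).
apply: le_trans (rnB _ _) (lerD _ qr).
by rewrite -(rint_annulus r0 rs qD).
Qed.

End CauchyEstimate.

(** * Holomorphic maps in several variables *)

Section Telescoping.
Variable U : zmodType.
Implicit Types a b c d l m p q f : U.

Lemma subr_telescope a b c : (a - b) + (b - c) = a - c.
Proof. by rewrite addrA subrK. Qed.

Lemma subr_sub_add a b c d : a - b - c = (a - (d + c)) - (b - d).
Proof. by rewrite [d + c]addrC opprD addrA opprB subr_telescope addrAC. Qed.

Lemma subr_add_sub2 l (m1 m2 : U) p q :
  l - (p + q) = - (m1 + m2 - l) + (m1 - p) + (m2 - q).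
Proof. by rewrite opprB -[RHS]addrA [m1 - p + _]addrACA -opprD subr_telescope. Qed.

Lemma subr_sub_sub2 (f1 f0 l a1 a0 m : U) :
  f1 - f0 - l = (a1 - a0 - m) - (a1 - f1) + (a0 - f0) + (m - l).
Proof.
rewrite -[a1 - a0 - m]addrA -opprD -[LHS]addrA -opprD opprB -[RHS]addrA.
by rewrite [a0 - f0 + _]addrACA -opprD [a1 - _ + _]addrC !subr_telescope.
Qed.

End Telescoping.

Section SeveralVariables.
Variables (R : realType) (n : nat).
Local Notation W := (tvec R n).

Lemma coef_ge0 (m k : nat) (B s : R) : 0 <= B -> 0 < s -> 0 <= m%:R * B / s ^+ k.
Proof. by move=> B0 s0; rewrite divr_ge0 ?mulr_ge0 ?ler0n ?exprn_ge0// ltW. Qed.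

Lemma diff_sub (V' : normedModType R[i]) (f g : V' -> W) x v :
  differentiable f x -> differentiable g x ->
  'd (fun y => f y - g y) x v = 'd f x v - 'd g x v.
Proof. by move=> fx gx; exact: (congr1 (fun h => h v) (diffB fx gx)). Qed.

Lemma is_derive_eps (phi : R -> R) (t l : R) :
  (forall e : R, 0 < e -> exists2 d : R, 0 < d &
    forall h, `|h| < d -> `|phi (t + h) - phi t - l * h| <= e * `|h|) ->
  is_derive t 1 phi l.
Proof.
move=> H.
have cv : (fun h : R => h^-1 *: ((phi \o shift t) (h *: 1) - phi t)) @ 0^' --> l.
  apply/cvgrPdist_le => e e0; have [d d0 dP] := H e e0.
  near=> h.
  have h0 : h != 0 by near: h; exact: nbhs_dnbhs_neq.
  have hd : `|h| < d.
    by near: h; apply: dnbhs0_lt.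
  have := dP h hd; rewrite /= /GRing.scale /= mulr1 [h + t]addrC => H1.
  rewrite distrC -(ler_pM2r (_ : 0 < `|h|)) ?normr_gt0// -normrM.
  suff -> : (h^-1 * (phi (t + h) - phi t) - l) * h = phi (t + h) - phi t - l * h by [].
  by field.
by split; [apply/cvg_ex; exists l|exact: cvg_lim].
Unshelve. all: by end_near. Qed.

Lemma real_cauchy (u : nat -> R) :
  (forall e : R, 0 < e -> exists K, forall k l, (K <= k)%N -> (K <= l)%N -> `|u k - u l| <= e) ->
  exists L : R, forall e : R, 0 < e -> exists K, forall k, (K <= k)%N -> `|u k - L| <= e.
Proof.
move=> uC; have : cvgn u.
  apply/cauchy_cvgP/cauchy_exP => e e0.
  have e2 : 0 < e / 2 by rewrite divr_gt0.
  have [K KP] := uC _ e2; exists (u K); exists K => // k /= Kk.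
  rewrite /ball /=; apply: le_lt_trans (KP _ _ (leqnn _) Kk) _.
  by rewrite ltr_pdivrMr// ltr_pMr// ltr1n.
move=> /cvg_ex[L /= uL]; exists L => e e0.
have /cvgrPdist_le/(_ _ e0)[K _ KP] := uL.
by exists K => k Kk; rewrite distrC; exact: KP.
Qed.

Lemma tvec_cauchy (u : nat -> W) :
  (forall e : R, 0 < e -> exists K, forall k l, (K <= k)%N -> (K <= l)%N -> rn (u k - u l) <= e) ->
  exists L : W, forall e : R, 0 < e -> exists K, forall k, (K <= k)%N -> rn (u k - L) <= e.
Proof.
move=> uC.
have reC i : exists L : R, forall e : R, 0 < e -> exists K, forall k, (K <= k)%N ->
    `|complex.Re (coord_tvec i (u k)) - L| <= e.
  apply: real_cauchy => e e0; have [K KP] := uC e e0; exists K => k l Kk Kl.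
  rewrite -ReB -coord_tvecB (le_trans (Re_rn _))// (le_trans (rn_coord_tvec _ _))//.
  exact: KP.
have imC i : exists L : R, forall e : R, 0 < e -> exists K, forall k, (K <= k)%N ->
    `|complex.Im (coord_tvec i (u k)) - L| <= e.
  apply: real_cauchy => e e0; have [K KP] := uC e e0; exists K => k l Kk Kl.
  rewrite -ImB -coord_tvecB (le_trans (Im_rn _))// (le_trans (rn_coord_tvec _ _))//.
  exact: KP.
have [a aP] := choice reC; have [b bP] := choice imC.
exists (tvec_of_coord (fun i => Complex (a i) (b i))) => e e0.
have e2 : 0 < e / 2 by rewrite divr_gt0.
have [Ka KaP] := choice (fun i => aP i _ e2); have [Kb KbP] := choice (fun i => bP i _ e2).
exists (\max_i maxn (Ka i) (Kb i)) => k kP.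
apply: rn_tvec_le => [|i]; first exact: ltW.
have := leq_trans (leq_bigmax (F := fun i => maxn (Ka i) (Kb i)) i) kP.
rewrite geq_max => /andP[/KaP ha /KbP hb].
rewrite coord_tvecB tvec_of_coordK (le_trans (rn_ReIm _))// ReB ImB /=.
by rewrite (le_trans (lerD ha hb))// -splitr.
Qed.

Variable V : normedModType R[i].
Implicit Types (f : V -> W) (x v w : V).

Definition holo_bounded f x (s B : R) :=
  forall y, rn (y - x) < s -> differentiable f y /\ rn (f y) <= B.

(** Each coordinate of z |-> f (x + z v) is a function of one complex variable on the disc of radius
    s / |v|, with derivative at 0 the coordinate of the differential on v. *)
Lemma cauchy_diff f x (s B : R) v : 0 < s -> holo_bounded f x s B ->
  rn ('d f x v) <= 24 * B / s * rn v.
Proof.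
move=> s0 fx; have fxx : rn (x - x) < s by rewrite subrr rn0.
have B0 : 0 <= B by apply: le_trans (fx x fxx).2; exact: rn_ge0.
have [->|v0] := eqVneq v 0; first by rewrite linear0 !rn0 mulr0.
have rv := rn_gt0 v0.
apply: rn_tvec_le => [|i]; first by rewrite mulr_ge0 ?rn_ge0// divr_ge0 ?mulr_ge0// ltW.
pose F (z : R[i]) := coord_tvec i (f (x + z *: v)).
have Fd z : rn z < s / rn v -> has_cderiv F z (coord_tvec i ('d f (x + z *: v) v)).
  rewrite ltr_pdivlMr// => zs e e0.
  have [|fd _] := fx (x + z *: v); first by rewrite addrC addKr rnZ.
  have e' : 0 < e / rn v by rewrite divr_gt0.
  have [d d0 dP] := diff_rn fd e'; exists (d / rn v); first by rewrite divr_gt0.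
  move=> w; rewrite ltr_pdivlMr// -rnZ => /dP.
  have -> : e / rn v * rn (w *: v) = e * rn w by rewrite rnZ; field; rewrite gt_eqF.
  move=> h.
  rewrite mulrC; apply: le_trans h; rewrite /F -coord_tvecZ -!coord_tvecB scalerDl addrA.
  have <- : 'd f (x + z *: v) (w *: v) = w *: 'd f (x + z *: v) v by exact: linearZ.
  exact: rn_coord_tvec.
have := @cauchy_estimate R F (coord_tvec i ('d f (x + 0 *: v) v)) (s / rn v) B.
rewrite scale0r addr0 => H.
have -> : 24 * B / s * rn v = 24 * B / (s / rn v) by field; rewrite !gt_eqF.
apply: H.
- by rewrite divr_gt0.
- by have := Fd 0; rewrite rn0 scale0r addr0; apply; rewrite divr_gt0.
- by move=> z /Fd h; exists (coord_tvec i ('d f (x + z *: v) v)).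
- move=> z; rewrite ltr_pdivlMr// => zs; apply: le_trans (rn_coord_tvec _ _) _.
  by apply: (fx _ _).2; rewrite addrC addKr rnZ.
Qed.

(** The mean value theorem holds for real functions, hence for the real and imaginary parts of each
    coordinate along the segment; adding the two gives the factor 2. *)
Lemma mean_value f x w (C : R) :
  (forall t : R, 0 <= t <= 1 -> differentiable f (x + t%:C *: w) /\
     rn ('d f (x + t%:C *: w) w) <= C) ->
  rn (f (x + w) - f x) <= 2 * C.
Proof.
move=> fC.
have C0 : 0 <= C.
  by have [|_ h] := fC 0; [rewrite lexx ler01|apply: le_trans h; exact: rn_ge0].
(* [p] is a real-linear functional of norm at most 1, later the real or imaginary part of a
   coordinate. *)
have key (p : W -> R) : (forall u u', p (u - u') = p u - p u') ->
   (forall (t : R) u, p (t%:C *: u) = t * p u) ->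
   (forall u, `|p u| <= rn u) -> `|p (f (x + w) - f x)| <= C.
  move=> pB pZ pR.
  pose phi t := p (f (x + t%:C *: w)).
  pose dphi t := p ('d f (x + t%:C *: w) w).
  have dP t : 0 <= t <= 1 -> forall e : R, 0 < e -> exists2 d : R, 0 < d &
      forall h, `|h| < d -> `|phi (t + h) - phi t - dphi t * h| <= e * `|h|.
    move=> /fC[fd _] e e0.
    have w1 : 0 < rn w + 1 by rewrite ltr_wpDl ?rn_ge0.
    have e' : 0 < e / (rn w + 1) by rewrite divr_gt0.
    have [d d0 dP] := diff_rn fd e'; exists (d / (rn w + 1)); first by rewrite divr_gt0.
    move=> h; rewrite ltr_pdivlMr// => hd.
    have hw : rn (h%:C *: w) < d.
      by rewrite rnZr; apply: le_lt_trans hd; rewrite ler_wpM2l// lerDl.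
    have := dP _ hw; rewrite rnZr => H.
    rewrite /phi /dphi mulrC -pZ -!pB rmorphD scalerDl addrA -linearZ.
    apply: le_trans (pR _) _; apply: le_trans H _.
    have -> : e / (rn w + 1) * (`|h| * rn w) = e * `|h| * (rn w / (rn w + 1)).
      by field; rewrite gt_eqF.
    rewrite ler_piMr ?mulr_ge0 ?(ltW e0)//.
    by rewrite ler_pdivrMr// mul1r lerDl.
  have cphi : {within `[0, 1], continuous (phi : R^o -> R^o)}.
    apply: within_continuous_itv => t t01 e e0.
    have [d d0 dP'] := dP t t01 1 ltr01.
    have D1 : 0 < 1 + `|dphi t| by rewrite ltr_pwDl.
    exists (Num.min d (e / (1 + `|dphi t|))); first by rewrite lt_min d0 divr_gt0.
    move=> s _; rewrite lt_min => /andP[/dP' h1]; rewrite ltr_pdivlMr// => h2.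
    move: h1; rewrite [t + _]addrC subrK mul1r => h1.
    rewrite -[phi s - phi t](subrK (dphi t * (s - t))).
    apply: le_lt_trans (ler_normD _ _) _; apply: le_lt_trans h2.
    by rewrite [leRHS]mulrDr mulr1 normrM [`|dphi t| * _]mulrC lerD2r.
  have [|c c01] := @MVT_segment R phi dphi 0 1 ler01 _ cphi.
    move=> t; rewrite in_itv /= => /andP[t0 t1]; apply: is_derive_eps; apply: dP.
    by rewrite !ltW.
  rewrite subr0 mulr1 /phi scale1r scale0r addr0 -pB => ->.
  apply: le_trans (pR _) _; apply: (fC c _).2.
  by move: c01; rewrite in_itv.
apply: rn_tvec_le => [|i]; first by rewrite mulr_ge0.
rewrite mulr_natl mulr2n; apply: le_trans (rn_ReIm _) (lerD _ _).
- apply: (key (fun u => complex.Re (coord_tvec i u))).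
  + by move=> u u'; rewrite coord_tvecB ReB.
  + by move=> t u; rewrite coord_tvecZ; case: (coord_tvec i u) => ? ? /=; rewrite mul0r subr0.
  + by move=> u; rewrite (le_trans (Re_rn _)) ?rn_coord_tvec.
- apply: (key (fun u => complex.Im (coord_tvec i u))).
  + by move=> u u'; rewrite coord_tvecB ImB.
  + by move=> t u; rewrite coord_tvecZ; case: (coord_tvec i u) => ? ? /=; rewrite mul0r addr0.
  + by move=> u; rewrite (le_trans (Im_rn _)) ?rn_coord_tvec.
Qed.

Lemma diff_translate f x w : differentiable f (x + w) ->
  differentiable (fun y => f (y + w)) x /\ 'd (fun y => f (y + w)) x = 'd f (x + w) :> (V -> W).
Proof.
move=> fd; have [C C0 CP] := diff_bound fd.
apply: (rn_differentiable (C := C)) => //; first exact: linearP.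
move=> e e0; have [d d0 dP] := diff_rn fd e0; exists d => // v /dP.
by have -> : x + w + v = x + v + w by rewrite addrAC.
Qed.

(** The segment from v to v + w stays within s of x, so Cauchy's estimate with radius s applies at
    each of its points; 48 is 24 times the 2 of [mean_value]. *)
Lemma holo_bounded_lip f x (s B : R) v w : 0 < s -> holo_bounded f x (2 * s) B ->
  rn (v - x) + rn w < s -> rn (f (v + w) - f v) <= 48 * B / s * rn w.
Proof.
move=> s0 fx vw.
have -> : 48 * B / s * rn w = 2 * (24 * B / s * rn w) by field; rewrite gt_eqF.
apply: mean_value => t /andP[t0 t1].
have tw : rn (t%:C *: w) <= rn w by rewrite rnZr ger0_norm// ler_piMl ?rn_ge0.
have tx : rn (v + t%:C *: w - x) < s.
  by rewrite addrAC; apply: le_lt_trans (rnD _ _) _; apply: le_lt_trans vw; rewrite lerD2l.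
split; first by apply: (fx _ _).1; apply: lt_trans tx _; rewrite ltr_pMl// ltr1n.
apply: cauchy_diff => // y yt; apply: fx.
rewrite -(subrK (v + t%:C *: w) y) -addrA; apply: le_lt_trans (rnD _ _) _.
by rewrite mulr_natl mulr2n; exact: ltrD.
Qed.

(* Cauchy's estimate for the increment [fun y => f (y + w) - f y], which is
   O(|w|): this gives second order control without a second derivative. *)
Lemma diff_lip f x (s B : R) v w : 0 < s -> holo_bounded f x (4 * s) B -> rn w < s ->
  rn ('d f (x + w) v - 'd f x v) <= 576 * B / s ^+ 2 * rn w * rn v.
Proof.
move=> s0 fx ws.
have s24 : 2 * s < 4 * s by lra.
have [|h1 h2] := @diff_translate f x w.
  by apply: (fx _ _).1; rewrite addrC addKr (lt_trans ws)// ltr_pMl// ltr1n.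
have fxd : differentiable f x by apply: (fx _ _).1; rewrite subrr rn0 mulr_gt0.
have -> : 'd f (x + w) v - 'd f x v = 'd (fun y => f (y + w) - f y) x v.
  exact: (esym (etrans (diff_sub v h1 fxd) (congr1 (fun h => h v - 'd f x v) h2))).
have -> : 576 * B / s ^+ 2 * rn w * rn v = 24 * (24 * B / s * rn w) / s * rn v.
  by field; rewrite gt_eqF.
apply: (@cauchy_diff (fun y => f (y + w) - f y) x s _ v s0) => y ys.
have fy : differentiable f y by apply: (fx _ _).1; apply: lt_trans ys _; lra.
have fyw : differentiable (fun y => f (y + w)) y.
  apply: (@diff_translate f y w _).1; apply: (fx _ _).1; rewrite addrAC.
  by apply: le_lt_trans (rnD _ _) _; lra.
split; first exact: differentiableB.
have -> : 24 * B / s * rn w = 48 * B / (2 * s) * rn w by field; rewrite gt_eqF.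
apply: (@holo_bounded_lip _ x) => //; first by rewrite mulr_gt0.
  by move=> z; rewrite mulrA => zs; apply: fx; rewrite (_ : 4 = 2 * 2) // -natrM.
by lra.
Qed.

(** The mean value estimate is applied to f minus its differential at x, whose derivative along the
    segment is an increment of the differential, controlled by [diff_lip]. *)
Lemma taylor2 f x (s B : R) w : 0 < s -> holo_bounded f x (4 * s) B -> rn w < s ->
  rn (f (x + w) - f x - 'd f x w) <= 1152 * B / s ^+ 2 * rn w ^+ 2.
Proof.
move=> s0 fx ws.
have fxd : differentiable f x by apply: (fx _ _).1; rewrite subrr rn0 mulr_gt0.
have B0 : 0 <= B.
  have [|_ h] := fx x; first by rewrite subrr rn0 mulr_gt0.
  by apply: le_trans h; exact: rn_ge0.
have K0 := coef_ge0 576 2 B0 s0.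
have dL y : differentiable ('d f x) y /\ 'd ('d f x) y = 'd f x :> (V -> W).
  have cL := diff_continuous fxd.
  by split; [exact: linear_differentiable|exact: diff_lin].
have -> : f (x + w) - f x - 'd f x w =
    (f (x + w) - 'd f x (x + w)) - (f x - 'd f x x).
  by rewrite linearD; exact: subr_sub_add.
have -> : 1152 * B / s ^+ 2 * rn w ^+ 2 = 2 * (576 * B / s ^+ 2 * rn w * rn w).
  by field; rewrite gt_eqF.
apply: (@mean_value (fun y => f y - 'd f x y)) => t /andP[t0 t1].
have tw : rn (t%:C *: w) <= rn w by rewrite rnZr ger0_norm// ler_piMl ?rn_ge0.
have fd : differentiable f (x + t%:C *: w).
  by apply: (fx _ _).1; rewrite addrC addKr; lra.
have [dL1 dL2] := dL (x + t%:C *: w).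
split; first exact: differentiableB.
have -> : 'd (fun y => f y - 'd f x y) (x + t%:C *: w) w =
    'd f (x + t%:C *: w) w - 'd f x w.
  by apply: etrans (diff_sub w fd dL1) _; congr (_ - _); exact: (congr1 (fun h => h w) dL2).
apply: le_trans (diff_lip _ s0 fx _) _; first lra.
apply: ler_wpM2r; first exact: rn_ge0.
by apply: ler_wpM2l; [exact: K0|exact: tw].
Qed.

(* The differentials converge by Cauchy's estimate, and the Taylor remainders are
   O(|w|^2) uniformly in k. *)
Lemma limit_differentiable (F : nat -> V -> W) f x (s B : R) : 0 < s ->
  (forall k, holo_bounded (F k) x (4 * s) B) ->
  (forall e : R, 0 < e -> exists K, forall k, (K <= k)%N -> forall y,
     rn (y - x) < 4 * s -> rn (F k y - f y) <= e) ->
  differentiable f x.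
Proof.
move=> s0 FB Ff.
have s40 : 0 < 4 * s by rewrite mulr_gt0.
have B0 : 0 <= B.
  have [|_ h] := FB 0%N x; first by rewrite subrr rn0 mulr_gt0.
  by apply: le_trans h; exact: rn_ge0.
have Fd k : differentiable (F k) x by apply: (FB k _ _).1; rewrite subrr rn0.
have dC v : exists L : W, forall e : R, 0 < e -> exists K, forall k, (K <= k)%N ->
    rn ('d (F k) x v - L) <= e.
  apply: tvec_cauchy => e e0.
  have v1 : 0 < rn v + 1 by rewrite ltr_wpDl ?rn_ge0.
  (* Two terms of the sequence differ by at most 2 e' on the ball; Cauchy's estimate with radius 4 s
     turns this into at most e. The + 1 covers v = 0. *)
  pose e' := e * s / (12 * (rn v + 1)).
  have e'0 : 0 < e' by rewrite divr_gt0 ?mulr_gt0.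
  have [K KP] := Ff _ e'0; exists K => k l Kk Kl.
  have -> : 'd (F k) x v - 'd (F l) x v = 'd (fun y => F k y - F l y) x v.
    by exact: (esym (diff_sub v (Fd k) (Fd l))).
  apply: le_trans (_ : 24 * (2 * e') / (4 * s) * rn v <= _).
    apply: (@cauchy_diff (fun y => F k y - F l y) x _ _ v s40) => y ys; split.
      by apply: differentiableB; [exact: (FB k _ _).1|exact: (FB l _ _).1].
    rewrite -(subrK (f y) (F k y)) -addrA mulr_natl mulr2n.
    apply: le_trans (rnD _ _) (lerD (KP _ Kk _ ys) _).
    by rewrite rn_distC; exact: KP.
  have -> : 24 * (2 * e') / (4 * s) * rn v = e * (rn v / (rn v + 1)).
    by rewrite /e'; field; rewrite !gt_eqF.
  by rewrite ler_piMr ?(ltW e0)// ler_pdivrMr// mul1r lerDl.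
have [L LP] := choice dC.
have rn_small (u : W) (C : R) : (forall e : R, 0 < e -> rn u <= C + e) -> rn u <= C.
  by move=> h; apply/ler_addgt0Pr => e /h.
have linL : linear L.
  move=> c u w; apply/eqP; rewrite -subr_eq0; apply/eqP/rn_eq0/eqP.
  rewrite eq_le rn_ge0 andbT; apply: rn_small => e e0; rewrite add0r.
  have c1 : 0 < rn c + 2 by rewrite ltr_wpDl ?rn_ge0.
  have e' : 0 < e / (rn c + 2) by rewrite divr_gt0.
  have [K1 h1] := LP (c *: u + w) _ e'; have [K2 h2] := LP u _ e'; have [K3 h3] := LP w _ e'.
  pose K := maxn K1 (maxn K2 K3).
  have {}h1 := h1 K (leq_maxl _ _).
  have {}h2 := h2 K (leq_trans (leq_maxl _ _) (leq_maxr _ _)).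
  have {}h3 := h3 K (leq_trans (leq_maxr _ _) (leq_maxr _ _)).
  have -> : L (c *: u + w) - (c *: L u + L w) =
    - ('d (F K) x (c *: u + w) - L (c *: u + w)) + c *: ('d (F K) x u - L u)
    + ('d (F K) x w - L w).
    have E : 'd (F K) x (c *: u + w) = c *: 'd (F K) x u + 'd (F K) x w by exact: linearP.
    by rewrite E scalerBr; exact: subr_add_sub2.
  have E : e = e / (rn c + 2) + rn c * (e / (rn c + 2)) + e / (rn c + 2).
    by field; rewrite gt_eqF.
  rewrite E; apply: le_trans (rnD _ _) (lerD _ h3).
  apply: le_trans (rnD _ _) (lerD _ _); first by rewrite rnN.
  by rewrite rnZ ler_wpM2l ?rn_ge0.
have LB v : rn (L v) <= 24 * B / (4 * s) * rn v.
  apply: rn_small => e e0; have [K h] := LP v _ e0.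
  rewrite -[L v](subKr ('d (F K) x v)); apply: le_trans (rnB _ _) (lerD _ (h K (leqnn _))).
  exact: (@cauchy_diff (F K) x _ _ v s40 (FB K)).
suff [] : differentiable f x /\ 'd f x = L :> (V -> W) by [].
apply: (rn_differentiable linL LB) => e e0.
pose C := 1152 * B / s ^+ 2.
have C0 : 0 <= C by exact: coef_ge0.
have C1 : 0 < C + 1 by rewrite ltr_wpDl.
exists (Num.min s (e / (C + 1))); first by rewrite lt_min s0 divr_gt0.
move=> w; rewrite lt_min => /andP[ws]; rewrite ltr_pdivlMr// => we.
apply: le_trans (_ : C * rn w ^+ 2 <= _); last first.
  rewrite expr2 mulrA ler_wpM2r ?rn_ge0// mulrC; apply: le_trans (ltW we).
  by rewrite ler_wpM2l ?rn_ge0// lerDl.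
apply: rn_small => d d0; have d3 : 0 < d / 3 by rewrite divr_gt0.
have [K1 h1] := Ff _ d3; have [K2 h2] := LP w _ d3.
pose K := maxn K1 K2.
have xw : rn (x + w - x) < 4 * s by rewrite addrC addKr (lt_trans ws)// ltr_pMl// ltr1n.
have xx : rn (x - x) < 4 * s by rewrite subrr rn0.
have g1 := h1 K (leq_maxl _ _) _ xw; have g2 := h1 K (leq_maxl _ _) _ xx.
have g3 := h2 K (leq_maxr _ _).
have g4 := taylor2 s0 (FB K) ws.
have -> : f (x + w) - f x - L w = (F K (x + w) - F K x - 'd (F K) x w)
   - (F K (x + w) - f (x + w)) + (F K x - f x) + ('d (F K) x w - L w).
  exact: subr_sub_sub2.
have -> : C * rn w ^+ 2 + d = C * rn w ^+ 2 + d / 3 + d / 3 + d / 3 by field.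
apply: le_trans (rnD _ _) (lerD _ g3); apply: le_trans (rnD _ _) (lerD _ g2).
by apply: le_trans (rnB _ _) (lerD g4 g1).
Qed.

End SeveralVariables.

(** * Holomorphy of the derivative along a holomorphic vector field *)

Section DerivativeAlong.
Variables (R : realType) (n : nat) (V : normedModType R[i]).
Implicit Types (f : V -> tvec R n) (g : V -> V).

(* The map is a uniform limit of the holomorphic difference quotients
   t^-1 (f (y + t g(y)) - f y) with t = 1 / (k + N + 1). *)
Lemma diff_along_differentiable f g (x : V) (r : R) : 0 < r ->
  (forall y, rn (y - x) < r -> differentiable f y /\ differentiable g y) ->
  differentiable (fun y => 'd f y (g y)) x.
Proof.
move=> r0 fg.
have [fx gx] : differentiable f x /\ differentiable g x by apply: fg; rewrite subrr rn0.
have [d1 d10 d1P] := differentiable_rn_continuous fx ltr01.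
have [d2 d20 d2P] := differentiable_rn_continuous gx ltr01.
pose B := rn (f x) + 1; pose C := rn (g x) + 1.
have B0 : 0 <= B by rewrite addr_ge0 ?rn_ge0.
have C0 : 0 <= C by rewrite addr_ge0 ?rn_ge0.
(* Of the radius 8 s on which f and g are controlled, one half is for the point y near x, the other
   for the ball about y on which [taylor2] is used. *)
pose s := Num.min r (Num.min d1 d2) / 8.
have s0 : 0 < s by rewrite divr_gt0// !lt_min r0 d10.
have [sr sd1 sd2] : [/\ 8 * s <= r, 8 * s <= d1 & 8 * s <= d2].
  by rewrite /s mulrC divfK// !ge_min !lexx ?orbT.
have fB y : rn (y - x) < 8 * s -> rn (f y) <= B.
  move=> h; rewrite -(subrK (f x) (f y)) addrC; apply: le_trans (rnD _ _) _.
  by rewrite lerD2l ltW// d1P// (lt_le_trans h).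
have gC y : rn (y - x) < 8 * s -> rn (g y) <= C.
  move=> h; rewrite -(subrK (g x) (g y)) addrC; apply: le_trans (rnD _ _) _.
  by rewrite lerD2l ltW// d2P// (lt_le_trans h).
have s48 y : rn (y - x) < 4 * s -> rn (y - x) < 8 * s.
  by move=> h; apply: lt_trans h _; rewrite ltr_pM2r// ltr_nat.
have fH y : rn (y - x) < 4 * s -> holo_bounded f y (4 * s) B.
  move=> yx z zy; have zx : rn (z - x) < 8 * s.
    rewrite -(subr_telescope z y x); apply: le_lt_trans (rnD _ _) _.
    have -> : 8 * s = 4 * s + 4 * s by ring.
    exact: ltrD.
  by split; [exact: (fg _ (lt_le_trans zx sr)).1|exact: fB].
(* The shift N makes t k * C < s for every k, so that the displacement t g(y) is admissible in
   [taylor2] from the first term on. *)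
have [N NP] : exists N : nat, C / s < N.+1%:R.
  exists (Num.bound (C / s)); have := archi_boundP (divr_ge0 C0 (ltW s0)).
  by move=> h; apply: lt_trans h _; rewrite ltr_nat.
pose t k : R := (k + N).+1%:R^-1.
have t0 k : 0 < t k by rewrite invr_gt0 ltr0n.
have t1 k : t k <= 1 by rewrite invf_le1 ?ltr0n// ler1n.
have tC k : t k * C < s.
  rewrite /t mulrC ltr_pdivrMr ?ltr0n// mulrC -ltr_pdivrMr//.
  by apply: lt_le_trans NP _; rewrite ler_nat ltnS leq_addl.
pose F k y := (t k)^-1%:C *: (f (y + (t k)%:C *: g y) - f y).
pose Q := 1152 * B / s ^+ 2 * C ^+ 2.
have Q0 : 0 <= Q by apply: mulr_ge0; [exact: coef_ge0|exact: sqr_ge0].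
have tg k y : rn (y - x) < 4 * s -> rn ((t k)%:C *: g y) <= t k * C.
  move=> /s48/gC yx; rewrite rnZr gtr0_norm//; apply: ler_wpM2l => //; exact: ltW.
have err k y : rn (y - x) < 4 * s -> rn (F k y - 'd f y (g y)) <= Q * t k.
  move=> yx; have tgs := le_lt_trans (tg k y yx) (tC k).
  have := taylor2 s0 (fH y yx) tgs.
  have E : 'd f y ((t k)%:C *: g y) = (t k)%:C *: 'd f y (g y) by exact: linearZ.
  move=> T; have -> : F k y - 'd f y (g y) = (t k)^-1%:C *:
      (f (y + (t k)%:C *: g y) - f y - 'd f y ((t k)%:C *: g y)).
    rewrite E [RHS]scalerBr scalerA -rmorphM mulVf ?gt_eqF//.
    by rewrite rmorph1 scale1r.
  rewrite rnZr gtr0_norm ?invr_gt0// mulrC ler_pdivrMr//.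
  have -> : Q * t k * t k = 1152 * B / s ^+ 2 * (t k * C) ^+ 2 by rewrite /Q; ring.
  apply: le_trans T _; apply: ler_wpM2l; first exact: coef_ge0.
  have h0 : 0 <= t k * C by apply: mulr_ge0 => //; exact: ltW.
  by apply: lerXn2r; rewrite ?nnegrE; [exact: rn_ge0|exact: h0|exact: tg].
apply: (@limit_differentiable R n V F _ x s (6 * B / s * C + Q)) => //.
- move=> k y yx; split.
    have [fy gy] := fg y (lt_le_trans (s48 _ yx) sr).
    apply: differentiableZ; apply: differentiableB => //.
    apply: (@differentiable_comp _ _ _ _ (fun y => y + (t k)%:C *: g y) f).
      by apply: differentiableD => //; exact: differentiableZ.
    apply: (fH y yx _ _).1; rewrite addrC addKr.
    apply: lt_trans (le_lt_trans (tg k y yx) (tC k)) _.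
    by rewrite ltr_pMl// ltr1n.
  rewrite -(subrK ('d f y (g y)) (F k y)) addrC; apply: le_trans (rnD _ _) (lerD _ _).
    have s40 : 0 < 4 * s by rewrite mulr_gt0.
    apply: le_trans (cauchy_diff _ s40 (fH y yx)) _.
    have -> : 24 * B / (4 * s) = 6 * B / s by field; rewrite gt_eqF.
    apply: ler_wpM2l; last exact: gC (s48 _ yx).
    by rewrite -[s]expr1; exact: coef_ge0.
  apply: le_trans (err k y yx) _; exact: ler_piMr.
- move=> e e0; have [K KP] : exists K : nat, Q / e < K%:R.
    by exists (Num.bound (Q / e)); rewrite archi_boundP// divr_ge0// ltW.
  exists K => k Kk y yx; apply: le_trans (err k y yx) _.
  rewrite /t ler_pdivrMr ?ltr0n// mulrC -ler_pdivrMr//.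
  by apply: le_trans (ltW KP) _; rewrite ler_nat (leq_trans Kk)// leqW// leq_addr.
Qed.

End DerivativeAlong.

(** * Numerical inequalities for the Gevrey weights *)

Section Sums.
Variable R : realType.

Lemma bernoulli (x : R) m : 0 <= x <= 1 -> 1 - m%:R * x <= (1 - x) ^+ m.
Proof.
move=> /andP[x0 x1]; elim: m => [|m IH]; first by rewrite mul0r subr0 expr0.
have x1' : 0 <= 1 - x by lra.
rewrite exprS; apply: le_trans (ler_wpM2l x1' IH).
have : 0 <= m%:R * x ^+ 2 by rewrite mulr_ge0 ?sqr_ge0.
by rewrite -[m.+1]addn1 natrD; nra.
Qed.

Lemma sum_invsq m : \sum_(1 <= k < m.+1) ((k%:R : R) ^+ 2)^-1 <= 2.
Proof.
(* The bound 2 is strengthened by a term 1 / (k + 1) so that induction applies. *)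
suff H k : \sum_(1 <= k < k.+2) ((k%:R : R) ^+ 2)^-1 <= 2 - (k.+1%:R)^-1.
  case: m => [|m]; first by rewrite big_geq.
  by apply: le_trans (H m) _; rewrite lerBlDr lerDl invr_ge0.
elim: k => [|k IH]; first by rewrite big_nat1 expr1n invr1; lra.
rewrite big_nat_recr//=; apply: le_trans (lerD IH (lexx _)) _.
have k0 : 0 <= k%:R :> R by [].
have -> : k.+2%:R = k%:R + 2 :> R by rewrite -addn2 natrD.
have -> : k.+1%:R = k%:R + 1 :> R by rewrite -addn1 natrD.
rewrite -subr_ge0.
have -> : 2 - (k%:R + 2)^-1 - (2 - (k%:R + 1)^-1 + ((k%:R + 2) ^+ 2)^-1) =
  1 / ((k%:R + 1) * (k%:R + 2) ^+ 2) :> R.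
  by field; apply/andP; split; rewrite gt_eqF// ltr_wpDl.
by rewrite divr_ge0// mulr_ge0 ?sqr_ge0 ?addr_ge0.
Qed.

(** For a + b = i, i^2 <= 2 (a^2 + b^2) gives 1 / (a^2 b^2) <= (2 / i^2) (1 / a^2 + 1 / b^2), and
    each of the two resulting sums is at most 2. *)
Lemma conv_invsq i : (0 < i)%N ->
  \sum_(1 <= k < i) (((k%:R : R) ^+ 2)^-1 * (((i - k)%N%:R : R) ^+ 2)^-1) <= 8 / i%:R ^+ 2.
Proof.
move=> i0; have i0' : 0 < i%:R :> R by rewrite ltr0n.
apply: le_trans (_ : \sum_(1 <= k < i) (2 / i%:R ^+ 2 *
   (((k%:R : R) ^+ 2)^-1 + (((i - k)%N%:R : R) ^+ 2)^-1)) <= _).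
  rewrite big_nat_cond [leRHS]big_nat_cond; apply: ler_sum => k /andP[/andP[k1 ki] _].
  have a0 : 0 < k%:R :> R by rewrite ltr0n.
  have b0 : 0 < (i - k)%:R :> R by rewrite ltr0n subn_gt0.
  have -> : i%:R = k%:R + (i - k)%:R :> R by rewrite -natrD subnKC// ltnW.
  move: a0 b0; set a : R := k%:R; set b : R := (i - k)%:R => a0 b0.
  have -> : 2 / (a + b) ^+ 2 * ((a ^+ 2)^-1 + (b ^+ 2)^-1) =
     (2 * (a ^+ 2 + b ^+ 2) / (a + b) ^+ 2) * ((a ^+ 2)^-1 * (b ^+ 2)^-1).
    by field; rewrite !gt_eqF// addr_gt0.
  rewrite ler_peMl ?mulr_ge0 ?invr_ge0 ?sqr_ge0//.
  rewrite ler_pdivlMr ?exprn_gt0 ?addr_gt0// mul1r.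
  by have := sqr_ge0 (a - b); nra.
rewrite -big_distrr /= big_split /=.
have rv : \sum_(1 <= k < i) (((i - k)%N%:R : R) ^+ 2)^-1 = \sum_(1 <= k < i) ((k%:R : R) ^+ 2)^-1.
  rewrite [RHS]big_nat_rev /= add1n; apply: eq_big_nat => k /andP[k1 ki].
  by rewrite subSS.
case: i i0 i0' rv => // i _ i0' ->.
have -> : 8 / i.+1%:R ^+ 2 = 2 / i.+1%:R ^+ 2 * (2 + 2) :> R by field; rewrite gt_eqF.
apply: ler_wpM2l; first by rewrite divr_ge0 ?sqr_ge0.
by apply: lerD; exact: sum_invsq.
Qed.

Lemma fact_mul_le a b : (a`! * b`! <= (a + b)`!)%N.
Proof.
by rewrite -(bin_fact (leq_addr b a)) addKn leq_pmull// bin_gt0 leq_addr.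
Qed.

End Sums.

(** * Gevrey estimates on shrinking domains *)

Section Tube.
Variables (R : realType) (n : nat).
Local Notation W := (tvec R n).
Variables (D : R -> set W) (r0 : R).
Hypothesis D_near : forall (r s : R) x y, D r x -> rn (y - x) < s -> D (r + s) y.
Implicit Types (X Y : W -> W) (r : R) (x : W).

Definition holoD Y := forall r x, 0 < r < r0 -> D r x -> differentiable Y x.

(* Nagumo-type bound with the Gevrey weight of the coefficient of eps^j. *)
Definition bnd (j : nat) Y (c : R) := forall r x, 0 < r < r0 -> D r x ->
  rn (Y x) * (r0 - r) ^+ j.-1 <= c * (j.-1)`!%:R.

Lemma eq_bnd j Y Y' c : (forall r x, 0 < r < r0 -> D r x -> Y x = Y' x) ->
  bnd j Y c -> bnd j Y' c.
Proof. by move=> YY' h r x r0' Dx; rewrite -(YY' r x)//; exact: h. Qed.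

Lemma bnd_le j Y c c' : c <= c' -> bnd j Y c -> bnd j Y c'.
Proof.
by move=> cc h r x r0' Dx; apply: le_trans (h _ _ r0' Dx) _; rewrite ler_wpM2r.
Qed.

Lemma bndD j X Y a b : bnd j X a -> bnd j Y b -> bnd j (fun x => X x + Y x) (a + b).
Proof.
move=> hX hY r x /[dup] rr /andP[_ rr0] Dx; rewrite mulrDl.
have d0 : 0 <= (r0 - r) ^+ j.-1 by rewrite exprn_ge0// subr_ge0 ltW.
apply: le_trans (lerD (hX _ _ rr Dx) (hY _ _ rr Dx)).
by rewrite -mulrDl ler_wpM2r// rnD.
Qed.

Lemma bndN j X a : bnd j X a -> bnd j (fun x => - X x) a.
Proof. by move=> hX r x rr Dx; rewrite rnN; exact: hX. Qed.

Lemma bndZ j X a (c : R[i]) : bnd j X a -> bnd j (fun x => c *: X x) (rn c * a).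
Proof.
by move=> hX r x rr Dx; rewrite rnZ -!mulrA ler_wpM2l ?rn_ge0//; exact: hX.
Qed.

Lemma bnd0 j : bnd j (fun=> 0) 0.
Proof. by move=> r x rr Dx; rewrite rn0 !mul0r. Qed.

Lemma bnd_sum j (I : Type) (s : seq I) (P : pred I) (X : I -> W -> W) (a : I -> R) :
  (forall i, P i -> bnd j (X i) (a i)) ->
  bnd j (fun x => \sum_(i <- s | P i) X i x) (\sum_(i <- s | P i) a i).
Proof.
move=> h; elim: s => [|i s IH].
  by rewrite big_nil; apply: eq_bnd (@bnd0 j) => r x _ _; rewrite big_nil.
rewrite big_cons; case: ifP => Pi.
  apply: eq_bnd (bndD (h _ Pi) IH) => r x _ _; by rewrite big_cons Pi.
by apply: eq_bnd IH => r x _ _; rewrite big_cons Pi.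
Qed.

(* Cauchy's estimate on a ball of radius (r0 - r) / 2j: one derivative costs
   exactly the passage from the weight (j-1)! to j!. *)
Lemma nagumo j Y c r x v : (0 < j)%N -> 0 <= c -> holoD Y -> bnd j Y c ->
  0 < r < r0 -> D r x -> rn ('d Y x v) * (r0 - r) ^+ j <= 96 * c * j`!%:R * rn v.
Proof.
case: j => // m _ c0 hY bY /andP[rp rr0] Dx; set d := r0 - r.
have d0 : 0 < d by rewrite subr_gt0.
have m1 : 0 < m.+1%:R :> R by rewrite ltr0n.
pose s := d / (2 * m.+1%:R).
have s0 : 0 < s by rewrite divr_gt0// mulr_gt0.
have sd : s <= d / 2.
  by rewrite /s invfM mulrA ler_piMr ?divr_ge0 ?(ltW d0)// invf_le1// ler1n.
have dm0 : 0 < d ^+ m by rewrite exprn_gt0.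
pose B := 2 * c * m`!%:R / d ^+ m.
have hb : holo_bounded Y x s B.
  move=> y ys; have Dy := D_near Dx ys.
  have rs : 0 < r + s < r0 by apply/andP; split; [exact: addr_gt0|rewrite /d in sd *; lra].
  split; first exact: hY Dy.
  have ds : (r0 - (r + s)) = d * (1 - 1 / (2 * m.+1%:R)).
    have E (M : R) : 0 < M -> r0 - (r + d / (2 * M)) = d * (1 - 1 / (2 * M)).
      by move=> M0; rewrite /d; field; rewrite gt_eqF.
    exact: E.
  have := bY _ _ rs Dy; rewrite /= ds exprMn => H.
  (* Bernoulli's inequality: at every order, enlarging r by this s costs at most a factor 2 in the
     weight. This is why the radius is divided by 2 (m + 1). *)
  have half : 1 / 2 <= (1 - 1 / (2 * m.+1%:R)) ^+ m :> R.
    apply: le_trans (bernoulli _ _); last first.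
      rewrite divr_ge0 ?mulr_ge0//= ler_pdivrMr ?mulr_gt0// mul1r.
      have : 1 <= m.+1%:R :> R by rewrite ler1n.
      lra.
    rewrite mulrA mulr1 lerBrDr -lerBrDl ler_pdivrMr ?mulr_gt0//.
    have : m.+1%:R = m%:R + 1 :> R by rewrite -addn1 natrD.
    lra.
  rewrite /B ler_pdivlMr//.
  have : rn (Y y) * (d ^+ m * (1 / 2)) <= c * m`!%:R.
    by apply: le_trans H; rewrite ler_wpM2l ?rn_ge0// ler_wpM2l// ltW.
  by rewrite mulrA; lra.
have := cauchy_diff v s0 hb.
(* 96 = 24 * 2 * 2: Cauchy's constant, the loss in [half], and the 2 in the denominator of s. *)
have -> : 24 * B / s = 96 * c * m.+1`!%:R / d ^+ m.+1.
  by rewrite factS natrM /B /s exprS; field; rewrite !gt_eqF ?pnatr_eq0.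
by rewrite mulrAC ler_pdivlMr ?exprn_gt0.
Qed.

Lemma holoD_along X Y : holoD X -> holoD Y -> holoD (fun x => 'd Y x (X x)).
Proof.
move=> hX hY r x /andP[rp rr0] Dx.
have d0 : 0 < (r0 - r) / 2 by rewrite divr_gt0// subr_gt0.
apply: (diff_along_differentiable d0) => y yx.
have rs : 0 < r + (r0 - r) / 2 < r0 by apply/andP; split; lra.
by split; [exact: hY rs (D_near Dx yx)|exact: hX rs (D_near Dx yx)].
Qed.

Lemma holoD_bracket X Y : holoD X -> holoD Y -> holoD (bracket X Y).
Proof.
move=> hX hY r x rr Dx.
by apply: differentiableB; [exact: (holoD_along hX hY rr Dx)|exact: (holoD_along hY hX rr Dx)].
Qed.

(** By [nagumo] the derivative of Y has weight i! / (r0 - r)^i, and X has (k - 1)! / (r0 - r)^(k -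
    1). The exponents add up to k + i - 1, and (k - 1)! i! <= (k + i - 1)!. *)
Lemma bnd_along k i X Y a b : (0 < k)%N -> (0 < i)%N -> 0 <= a -> 0 <= b ->
  holoD Y -> bnd k X a -> bnd i Y b ->
  bnd (k + i) (fun x => 'd Y x (X x)) (96 * (a * b)).
Proof.
case: k => // k _ i0 a0 b0 hY bX bY r x rr Dx.
have d0 : 0 <= r0 - r by rewrite subr_ge0 ltW//; case/andP: rr.
have h1 := nagumo (X x) i0 b0 hY bY rr Dx; have h2 := bX _ _ rr Dx.
rewrite addSn /= exprD mulrA mulrAC.
apply: le_trans (ler_wpM2r (exprn_ge0 _ d0) h1) _.
rewrite -[X in X <= _]mulrA; apply: le_trans (ler_wpM2l _ h2) _.
  by rewrite !mulr_ge0.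
have -> : 96 * b * i`!%:R * (a * k`!%:R) = 96 * (a * b) * (k`! * i`!)%:R :> R.
  by rewrite natrM; ring.
rewrite ler_wpM2l ?mulr_ge0// ler_nat; exact: fact_mul_le.
Qed.

Lemma bnd_bracket k i X Y a b : (0 < k)%N -> (0 < i)%N -> 0 <= a -> 0 <= b ->
  holoD X -> holoD Y -> bnd k X a -> bnd i Y b ->
  bnd (k + i) (bracket X Y) (192 * (a * b)).
Proof.
move=> k0 i0 a0 b0 hX hY bX bY.
have -> : 192 * (a * b) = 96 * (a * b) + 96 * (b * a) by ring.
have h1 := bnd_along k0 i0 a0 b0 hY bX bY.
have h2 := bnd_along i0 k0 b0 a0 hX bY bX; rewrite addnC in h2.
have H := bndD h1 (bndN h2).
by apply: eq_bnd H => r x _ _; rewrite /bracket.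
Qed.


(* The constant of [bnd_bracket]; folded, so that it is never computed in unary. *)
Definition brk : R := 192.

Lemma brk_ge0 : 0 <= brk. Proof. by rewrite /brk ler0n. Qed.

(* [formal_Lie] in a fixed chart. *)
Definition fLie (g Y : nat -> W -> W) : nat -> W -> W :=
  fun j x => \sum_(1 <= k < j.+1) bracket (g k) (Y (j - k)%N) x.

Lemma fLie0 g (Y : nat -> W -> W) : fLie g Y 0 = fun=> 0.
Proof. by apply/funext => x; rewrite /fLie big_geq. Qed.

Lemma bracket0 X : bracket X (fun=> 0) = fun=> 0.
Proof.
apply/funext => x; rewrite /bracket.
have E : 'd (fun=> 0 : W) x (X x) = 0 by exact: (congr1 (fun h => h (X x)) (diff_cst (0 : W) x)).
have E2 : 'd X x 0 = 0 by exact: linear0.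
exact: etrans (congr2 (fun a b => a - b) E E2) (subr0 0).
Qed.

(** Once the coefficient of order 0 vanishes, order j involves only orders strictly between 0 and j
    of both series; this makes the recursion for U and g well founded. *)
Lemma fLie_trunc g (Y : nat -> W -> W) j : (0 < j)%N -> Y 0%N = (fun=> 0) ->
  fLie g Y j = fun x => \sum_(1 <= k < j) bracket (g k) (Y (j - k)%N) x.
Proof.
by move=> j0 Y0; apply/funext => x; rewrite /fLie big_nat_recr//= subnn Y0 bracket0 addr0.
Qed.

Lemma holoD_sum (I : Type) (s : seq I) (P : pred I) (X : I -> W -> W) :
  (forall i, P i -> holoD (X i)) -> holoD (fun x => \sum_(i <- s | P i) X i x).
Proof.
move=> h r x rr Dx; elim: s => [|i s IH].
  have -> : (fun x => \sum_(i <- [::] | P i) X i x) = fun=> 0 by apply/funext => y; rewrite big_nil.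
  exact: differentiable_cst.
case Pi : (P i).
  have -> : (fun x => \sum_(i <- i :: s | P i) X i x) =
    fun x => X i x + \sum_(i <- s | P i) X i x by apply/funext => y; rewrite big_cons Pi.
  by apply: differentiableD; [exact: h Dx|exact: IH].
have -> : (fun x => \sum_(i <- i :: s | P i) X i x) =
    fun x => \sum_(i <- s | P i) X i x by apply/funext => y; rewrite big_cons Pi.
exact: IH.
Qed.

Lemma holoD_fLie g (Y : nat -> W -> W) : (forall k, (0 < k)%N -> holoD (g k)) -> (forall j, holoD (Y j)) ->
  forall j, holoD (fLie g Y j).
Proof.
move=> hg hY j r x rr Dx.
(* The explicit condition 0 < k is recorded because g 0 carries no hypothesis. *)
have -> : fLie g Y j = fun x => \sum_(1 <= k < j.+1 | (0 < k)%N) bracket (g k) (Y (j - k)%N) x.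
  apply/funext => y; rewrite /fLie big_nat_cond [RHS]big_nat_cond; apply: eq_bigl => k.
  by case: k.
have hb k : (0 < k)%N -> holoD (bracket (g k) (Y (j - k)%N)).
  by move=> k0; apply: holoD_bracket; [exact: hg|exact: hY].
exact: (@holoD_sum nat (index_iota 1 j.+1) (fun k => (0 < k)%N) _ hb r x rr Dx).
Qed.

Lemma holoD_iter g (Y : nat -> W -> W) m : (forall k, (0 < k)%N -> holoD (g k)) -> (forall j, holoD (Y j)) ->
  forall j, holoD (iter m (fLie g) Y j).
Proof. by move=> hg hY; elim: m => [//|m IH] /=; exact: holoD_fLie. Qed.

(* The weights 1 / k^2 are stable under convolution up to the factor 8. *)
Lemma iter_fLie_bound g U j (s w l : R) m : 0 <= s -> 0 <= w -> 0 <= l ->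
  (forall k, (0 < k)%N -> holoD (g k)) -> (forall i, holoD (U i)) -> U 0%N = (fun=> 0) ->
  (forall k, (0 < k < j)%N -> bnd k (g k) (s * (l ^+ k / k%:R ^+ 2))) ->
  (forall k, (0 < k < j)%N -> bnd k (U k) (w * (l ^+ k / k%:R ^+ 2))) ->
  forall i, (0 < i)%N -> (i + (m == 0%N) <= j)%N ->
  bnd i (iter m (fLie g) U i) ((8 * brk * s) ^+ m * (w * (l ^+ i / i%:R ^+ 2))).
Proof.
move=> s0 w0 l0 hg hU U0 bg bU; have K0 := brk_ge0.
(* The term (m == 0) in the range of i excludes i = j for U itself, whose coefficient j is not yet
   bounded; after one bracket, i = j is allowed. *)
elim: m => [|m IH] i i0 ij.
  by rewrite expr0 mul1r; apply: bU; rewrite i0 -addn1.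
have it0 : iter m (fLie g) U 0%N = fun=> 0 by case: (m) => [//|m'] /=; exact: fLie0.
rewrite iterS fLie_trunc//.
have ij' : (i <= j)%N by rewrite addn0 in ij.
have q0 : 0 <= 8 * brk * s by rewrite !mulr_ge0.
pose G k := s * (l ^+ k / k%:R ^+ 2); pose H k := (8 * brk * s) ^+ m * (w * (l ^+ k / k%:R ^+ 2)).
have H1 : bnd i (fun x => \sum_(1 <= k < i | (1 <= k < i)%N && true)
     bracket (g k) (iter m (fLie g) U (i - k)%N) x)
    (\sum_(1 <= k < i | (1 <= k < i)%N && true) brk * (G k * H (i - k)%N)).
  apply: bnd_sum => k /andP[/andP[k1 ki] _].
  have ik : (0 < i - k)%N by rewrite subn_gt0.
  have {1}-> : i = (k + (i - k))%N by rewrite subnKC// ltnW.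
  apply: bnd_bracket => //.
  - by rewrite /G mulr_ge0// divr_ge0 ?exprn_ge0.
  - by rewrite /H mulr_ge0 ?exprn_ge0// mulr_ge0// divr_ge0 ?exprn_ge0.
  - exact: hg.
  - exact: holoD_iter.
  - by apply: bg; rewrite k1 (leq_trans ki).
  - apply: IH => //; apply: leq_trans (leq_trans _ ij'); last exact: leqnn.
    by apply: leq_trans (_ : (i - k + 1 <= i)%N); [rewrite leq_add2l; case: (m)|rewrite addn1 ltn_subrL k1 i0].
apply: bnd_le (eq_bnd _ H1); last by move=> r x _ _; rewrite -big_nat_cond.
rewrite -big_nat_cond.
have -> : \sum_(1 <= k < i) brk * (G k * H (i - k)%N) =
   brk * s * (8 * brk * s) ^+ m * w * l ^+ i *
   \sum_(1 <= k < i) (((k%:R : R) ^+ 2)^-1 * (((i - k)%N%:R : R) ^+ 2)^-1).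
  rewrite big_distrr /=; apply: eq_big_nat => k /andP[k1 ki].
  have -> : l ^+ i = l ^+ k * l ^+ (i - k) by rewrite -exprD subnKC// ltnW.
  rewrite /G /H; ring.
apply: le_trans (ler_wpM2l _ (conv_invsq R i0)) _.
  by rewrite !mulr_ge0 ?exprn_ge0.
by rewrite le_eqVlt; apply/orP; left; apply/eqP; rewrite [_ ^+ m.+1]exprS; ring.
Qed.

(** Comparison with 1/2 + 1/4 + ... through 1 / k! <= 1. The total 1 lets the estimate for U
    reproduce its own constant. *)
Lemma half_series (q : R) j : 0 <= q -> q <= 1 / 2 ->
  \sum_(2 <= k < j.+1) rn ((k`!%:R : R[i])^-1) * q ^+ k.-1 <= 1.
Proof.
move=> q0 q2.
suff H m : \sum_(2 <= k < m.+2) rn ((k`!%:R : R[i])^-1) * q ^+ k.-1 <= 1 - (1 / 2) ^+ m.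
  case: j => [|j]; first by rewrite big_geq.
  by apply: le_trans (H j) _; rewrite lerBlDr lerDl exprn_ge0.
elim: m => [|m IH]; first by rewrite big_geq// expr0 subrr.
rewrite big_nat_recr//=; apply: le_trans (lerD IH (_ : _ <= (1 / 2) ^+ m.+1)) _.
  apply: le_trans (_ : 1 * (1 / 2) ^+ m.+1 <= _); last by rewrite mul1r.
  apply: ler_pM => //; [exact: rn_ge0|exact: exprn_ge0| |].
    by rewrite rnV rn_nat invf_le1 ?ltr0n ?fact_gt0// ler1n fact_gt0.
  by apply: lerXn2r; rewrite ?nnegrE//; lra.
rewrite exprS; lra.
Qed.

(* [formal_lift] of the constant vector field u in a fixed chart, with H the lift
   of u. *)
Definition seed (H : W -> W) (u : 'rV[R[i]]_n) : nat -> W -> W := fun j =>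
  match j with 0 => fun=> (0, u) | 1 => H | _ => fun=> 0 end.

Hypothesis D_star : forall r x (t : R), D r x -> 0 <= t <= 1 -> D r (x.1, t%:C *: x.2).

(** The fibre segment from (x.1, 0) to x stays in the same D r, so no radius is lost and the weight
    is unchanged. The direction u is itself the fibre coordinate of a point of D r, and is bounded
    as such; the 2 is that of [mean_value]. *)
Lemma bnd_fibre_integral j Y (A C : R) : holoD Y ->
  (forall r x, 0 < r < r0 -> D r x -> rn (Y (x.1, 0)) * (r0 - r) ^+ j.-1 <= A * (j.-1)`!%:R) ->
  (forall r x u, 0 < r < r0 -> D r x -> D r (x.1, u) -> rn ('d Y x (0, u)) * (r0 - r) ^+ j.-1 <= C * (j.-1)`!%:R) ->
  bnd j Y (A + 2 * C).
Proof.
move=> hY hA hC r x rr Dx.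
have d0 : 0 < (r0 - r) ^+ j.-1 by rewrite exprn_gt0// subr_gt0; case/andP: rr.
have E (t : R) : (x.1, 0) + t%:C *: (0, x.2) = (x.1, t%:C *: x.2) :> W.
  by congr pair => /=; rewrite ?scaler0 ?addr0 ?add0r.
have mv := @mean_value R n W Y (x.1, 0) (0, x.2) (C * (j.-1)`!%:R / (r0 - r) ^+ j.-1).
have xE : (x.1, 0) + (0, x.2) = x by case: (x) => a b; congr pair; rewrite /= ?addr0 ?add0r.
rewrite xE in mv.
have {}mv : rn (Y x - Y (x.1, 0)) <= 2 * (C * (j.-1)`!%:R / (r0 - r) ^+ j.-1).
  apply: mv => t t01; rewrite E; split; first exact: hY (D_star Dx t01).
  rewrite ler_pdivlMr//; apply: hC => //; first exact: D_star.
  by case: (x) Dx.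
rewrite -(subrK (Y (x.1, 0)) (Y x)) mulrDl addrC.
apply: le_trans (_ : (rn (Y (x.1, 0)) + rn (Y x - Y (x.1, 0))) * (r0 - r) ^+ j.-1 <= _).
  by apply: ler_wpM2r; [exact: ltW|exact: rnD].
rewrite mulrDl; apply: lerD; first exact: hA.
by rewrite -ler_pdivlMr// -!mulrA in mv *.
Qed.

End Tube.

(** * The inductive estimate for the gauge transformation in one chart *)

Section GaugeBounds.
Variables (R : realType) (n : nat).
Local Notation W := (tvec R n).
Variables (D : R -> set W) (r0 : R).
Hypothesis r01 : r0 <= 1.
Hypothesis D_near : forall (r s : R) x y, D r x -> rn (y - x) < s -> D (r + s) y.
Hypothesis D_star : forall r x (t : R), D r x -> 0 <= t <= 1 -> D r (x.1, t%:C *: x.2).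
Variables (g : nat -> W -> W) (H h : 'rV[R[i]]_n -> W -> W).
Hypothesis hg : forall k, (0 < k)%N -> holoD D r0 (g k).
Hypothesis hH : forall u, holoD D r0 (H u).
Hypothesis rel : forall u j r x, (0 < j)%N -> 0 < r < r0 -> D r x ->
  \sum_(k < j.+1) (k`!%:R : R[i])^-1 *: iter k (fLie g) (seed (H u) u) j x =
  if j == 1%N then h u x else 0.

(* The coefficients of [g, A^st] applied to the constant vector field u. *)
Let U u := fLie g (seed (H u) u).

Lemma holoD_seed u j : holoD D r0 (seed (H u) u j).
Proof.
case: j => [|[|j]]; [|exact: hH|]; by move=> r x _ _; exact: differentiable_cst.
Qed.

Lemma holoD_U u j : holoD D r0 (U u j).
Proof. by apply: holoD_fLie => //; exact: holoD_seed. Qed.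

Lemma bracket_seed0 u X x : bracket X (seed (H u) u 0) x = - 'd X x (0, u).
Proof.
rewrite /bracket /=.
have E : 'd (fun=> (0, u) : W) x (X x) = 0.
  exact: (congr1 (fun h => h (X x)) (diff_cst ((0, u) : W) x)).
exact: etrans (congr1 (fun a => a - 'd X x (0, u)) E) (sub0r _).
Qed.

Lemma U1E u x : U u 1 x = - 'd (g 1) x (0, u).
Proof. by rewrite /U /fLie big_nat1 subnn; exact: bracket_seed0. Qed.

(** [seed] has nonzero coefficients in orders 0 and 1 only, so just the two brackets of highest
    order in g survive; as v_u is constant, the last is a pure fibre derivative. *)
Lemma UE u j x : U u j.+2 x = bracket (g j.+1) (H u) x - 'd (g j.+2) x (0, u).
Proof.
rewrite /U /fLie big_nat_recr//= subnn bracket_seed0 big_nat_recr//= subSnn /= big1_seq ?add0r//.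
move=> k /andP[_]; rewrite mem_index_iota => /andP[k1 kj].
have -> : seed (H u) u (j.+2 - k)%N = fun=> 0.
  by have -> : (j.+2 - k)%N = (j - k).+2 by rewrite -[j.+2]addn2 -addnBAC// addn2.
by rewrite bracket0.
Qed.

Lemma U1_rel u r x : 0 < r < r0 -> D r x -> U u 1 x = h u x - H u x.
Proof.
move=> rr Dx; have := rel u (ltn0Sn 0) rr Dx.
rewrite big_ord_recl big_ord_recl big_ord0 /= !invr1 !scale1r addr0 => <-.
by rewrite addrC addKr.
Qed.

(** The gauge relation is solved for its term k = 1, which is U. In the terms k >= 2 at least one
    bracket acts on U, which vanishes in order 0, so they involve only lower orders. *)
Lemma U_rel u j r x : 0 < r < r0 -> D r x -> U u j.+2 x =
  - \sum_(2 <= k < j.+3) (k`!%:R : R[i])^-1 *: iter k.-1 (fLie g) (U u) j.+2 x.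
Proof.
move=> rr Dx; have := rel u (ltn0Sn j.+1) rr Dx.
rewrite -(big_mkord xpredT (fun k => (k`!%:R : R[i])^-1 *: iter k (fLie g) (seed (H u) u) j.+2 x)).
rewrite big_ltn// big_ltn//= scaler0 add0r !invr1 scale1r => E.
apply/eqP; rewrite -subr_eq0 opprK -[X in _ == X]E; apply/eqP; congr (_ + _).
apply: eq_big_nat => k /andP[k2 _]; case: k k2 => // k _.
by rewrite iterSr.
Qed.

(** [L] bounds the fibre coordinates on the domains, hence the directions of integration; [w] bounds
    both connections on vectors of norm at most L. [A] and [a] express the convergence of the Borel
    transform on the zero section. *)
Variables (L w A a : R).
Hypothesis w0 : 0 <= w.
Hypothesis A0 : 0 <= A.
Hypothesis a0 : 0 < a.
Hypothesis bH : forall u, rn u <= L -> bnd D r0 1 (H u) w.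
Hypothesis bh : forall u, rn u <= L -> bnd D r0 1 (h u) w.
Hypothesis DL : forall r x, 0 < r < r0 -> D r x -> rn x.2 <= L.
Hypothesis gzero : forall j r x, (0 < j)%N -> 0 < r < r0 -> D r x ->
  rn (g j (x.1, 0)) <= A * a ^+ j * (j.-1)`!%:R.

(* s makes the ratio 8 brk s of the series of iterated brackets equal to 1/2; each
   of the last three terms of l absorbs one contribution to g_j: the values on the
   zero section, the bracket [g_(j-1), H], and h - H. *)
Let s : R := 1 / (16 * brk R).
Let l : R := 1 + 4 * a * (1 + 3 * A / s) + 24 * brk R * w + 12 * w / s.
Let gam j : R := l ^+ j / j%:R ^+ 2.

Let brk_gt0 : 0 < brk R. Proof. by rewrite /brk ltr0n. Qed.
Let s_gt0 : 0 < s. Proof. by rewrite divr_gt0// mulr_gt0. Qed.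

Let c_ge0 : 0 <= 3 * A / s.
Proof. by apply: divr_ge0; [exact: mulr_ge0|exact: ltW]. Qed.

Let l_ge : [/\ 1 <= l, 4 * a * (1 + 3 * A / s) <= l, 24 * brk R * w <= l & 12 * w / s <= l].
Proof.
have h1 : 0 <= 4 * a * (1 + 3 * A / s).
  by apply: mulr_ge0; [rewrite mulr_ge0// ltW|exact: addr_ge0].
have h2 : 0 <= 24 * brk R * w by rewrite !mulr_ge0 ?(ltW brk_gt0).
have h3 : 0 <= 12 * w / s by apply: divr_ge0; [exact: mulr_ge0|exact: ltW].
by move: h1 h2 h3; rewrite /l; set x := 4 * a * _; set y := 24 * _ * _; set z := 12 * w / s => *; split; lra.
Qed.

Let l_gt0 : 0 < l. Proof. by have [h1 _ _ _] := l_ge; exact: lt_le_trans h1. Qed.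
Let gam_ge0 j : 0 <= gam j.
Proof. by rewrite divr_ge0 ?exprn_ge0// ltW. Qed.

(** j^2 <= 4^j removes the denominator of [gam]. The constant 3 A / s is absorbed by a single one of
    the j factors 1 + 3 A / s, and j > 0 provides one. *)
Let gam_zero j : (0 < j)%N -> A * a ^+ j <= s / 3 * gam j.
Proof.
move=> j0; have j0' : 0 < j%:R :> R by rewrite ltr0n.
rewrite /gam mulrA ler_pdivlMr ?exprn_gt0//.
have j4 : j%:R ^+ 2 <= 4 ^+ j :> R.
  have -> : 4 = 2 ^+ 2 :> R by rewrite expr2 -natrM.
  rewrite exprAC; apply: lerXn2r; rewrite ?nnegrE ?exprn_ge0//.
  by rewrite -natrX ler_nat ltnW// ltn_expl.
apply: le_trans (ler_wpM2l _ j4) _; first by rewrite mulr_ge0 ?exprn_ge0// ltW.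
have c1 : 1 <= 1 + 3 * A / s by rewrite lerDl.
have [_ lb _ _] := l_ge.
have H1 : (4 * a * (1 + 3 * A / s)) ^+ j <= l ^+ j.
  by apply: lerXn2r; rewrite ?nnegrE ?(ltW l_gt0)// !mulr_ge0 ?(ltW a0)// (le_trans ler01).
have H2 : (4 * a) ^+ j * (3 * A / s) <= l ^+ j.
  apply: le_trans H1; rewrite [leRHS]exprMn; apply: ler_wpM2l.
    by rewrite exprn_ge0// mulr_ge0// ltW.
  case: j j0 {j0' j4} => // j _; rewrite exprS.
  apply: le_trans (_ : (1 + 3 * A / s) * 1 <= _); first by rewrite mulr1 lerDr.
  by apply: ler_wpM2l; [exact: le_trans c1|exact: exprn_ege1].
have -> : A * a ^+ j * 4 ^+ j = s / 3 * ((4 * a) ^+ j * (3 * A / s)).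
  by rewrite [(4 * a) ^+ j]exprMn; field; rewrite gt_eqF.
by apply: ler_wpM2l => //; rewrite divr_ge0// ltW.
Qed.

(** (j + 2)^2 <= 4 (j + 1)^2, and [gam j.+2] has one more factor l, which exceeds 24 brk w; here 24
    = 2 * 4 * 3. *)
Let gam_step j : 2 * (brk R * (s * gam j.+1 * w)) <= s / 3 * gam j.+2.
Proof.
have j1 : 0 < j.+1%:R :> R by rewrite ltr0n.
have j2 : 0 < j.+2%:R :> R by rewrite ltr0n.
have [_ _ lb _] := l_ge.
have h1 : j.+2%:R ^+ 2 <= 4 * j.+1%:R ^+ 2 :> R.
  have -> : j.+2%:R = j%:R + 2 :> R by rewrite -addn2 natrD.
  have -> : j.+1%:R = j%:R + 1 :> R by rewrite -addn1 natrD.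
  have : 0 <= j%:R :> R by []. nra.
have h2 : gam j.+1 <= 4 * (l ^+ j.+1 / j.+2%:R ^+ 2).
  rewrite /gam ler_pdivrMr ?exprn_gt0//.
  have -> : 4 * (l ^+ j.+1 / j.+2%:R ^+ 2) * j.+1%:R ^+ 2 =
    l ^+ j.+1 * ((4 * j.+1%:R ^+ 2) / j.+2%:R ^+ 2) by ring.
  by rewrite ler_peMr ?exprn_ge0 ?(ltW l_gt0)// ler_pdivlMr ?exprn_gt0// mul1r.
apply: le_trans (_ : 2 * (brk R * (s * (4 * (l ^+ j.+1 / j.+2%:R ^+ 2)) * w)) <= _).
  apply: ler_wpM2l => //; apply: ler_wpM2l; first exact: ltW.
  by apply: ler_wpM2r => //; apply: ler_wpM2l => //; exact: ltW.
have -> : 2 * (brk R * (s * (4 * (l ^+ j.+1 / j.+2%:R ^+ 2)) * w)) =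
   s / 3 * ((24 * brk R * w) * (l ^+ j.+1 / j.+2%:R ^+ 2)) by field; rewrite gt_eqF.
apply: ler_wpM2l; first by rewrite divr_ge0// ltW.
have -> : gam j.+2 = l * (l ^+ j.+1 / j.+2%:R ^+ 2) by rewrite /gam exprS mulrA.
by apply: ler_wpM2r => //; rewrite divr_ge0 ?exprn_ge0 ?(ltW l_gt0).
Qed.

(** The budget s for g_j splits into three thirds: the zero section, twice the s / 6 of U_j, and
    twice the bracket of g_(j-1) with H_u. *)
Lemma gauge_step j : (0 < j)%N ->
  (forall k, (0 < k < j)%N -> bnd D r0 k (g k) (s * gam k)) ->
  (forall k u, (0 < k < j)%N -> rn u <= L -> bnd D r0 k (U u k) (s / 6 * gam k)) ->
  (forall u, rn u <= L -> bnd D r0 j (U u j) (s / 6 * gam j)) /\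
  bnd D r0 j (g j) (s * gam j).
Proof.
move=> j0 IHg IHU.
have bU u : rn u <= L -> bnd D r0 j (U u j) (s / 6 * gam j).
  move=> uL; case: j j0 IHg IHU => // -[|j] _ IHg IHU.
    (* For j = 1, U_1 = h_u - H_u is at most 2 w, and l >= 12 w / s gives 2 w <= (s / 6) l. *)
    apply: bnd_le (_ : w + w <= _) _.
      have [_ _ _ lb] := l_ge; rewrite /gam expr1 expr1n divr1.
      have -> : w + w = s / 6 * (12 * w / s) by field; rewrite gt_eqF.
      by apply: ler_wpM2l => //; rewrite divr_ge0// ltW.
    apply: eq_bnd (bndD (bh uL) (bndN (bH uL))) => r x rr Dx.
    by rewrite (U1_rel u rr Dx).
  (* Each further bracket with g multiplies the bound by this ratio, so by [half_series] the whole
     tail is at most the bound assumed for U. *)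
  have q1 : 8 * brk R * s = 1 / 2.
    have E (b : R) : b != 0 -> 8 * b * (1 / (16 * b)) = 1 / 2 by move=> b0; field.
    by apply: E; rewrite gt_eqF.
  have h1 : bnd D r0 j.+2 (fun x => \sum_(2 <= k < j.+3 | (2 <= k < j.+3)%N && true)
      (k`!%:R : R[i])^-1 *: iter k.-1 (fLie g) (U u) j.+2 x)
    (\sum_(2 <= k < j.+3 | (2 <= k < j.+3)%N && true)
      rn ((k`!%:R : R[i])^-1) * ((8 * brk R * s) ^+ k.-1 * (s / 6 * gam j.+2))).
    apply: bnd_sum => k /andP[/andP[k2 kj] _]; apply: bndZ.
    apply: (@iter_fLie_bound _ _ D r0 D_near g (U u) j.+2) => //.
    - exact: ltW.
    - by rewrite divr_ge0// ltW.
    - exact: ltW.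
    - exact: holoD_U.
    - exact: fLie0.
    - by move=> i ij; exact: IHU.
    - by case: k k2 {kj} => [|[|k]]//= _; rewrite addn0.
  apply: bnd_le (eq_bnd _ (bndN h1)); last first.
    by move=> r x rr Dx; rewrite (U_rel u j rr Dx) -big_nat_cond.
  rewrite -big_nat_cond q1.
  have -> : \sum_(2 <= k < j.+3) rn ((k`!%:R : R[i])^-1) * ((1 / 2) ^+ k.-1 * (s / 6 * gam j.+2)) =
     (\sum_(2 <= k < j.+3) rn ((k`!%:R : R[i])^-1) * (1 / 2) ^+ k.-1) * (s / 6 * gam j.+2).
    by rewrite mulr_suml; apply: eq_bigr => k _; exact: mulrA.
  rewrite ler_piMl//; first by rewrite mulr_ge0// divr_ge0// ltW.
  by apply: half_series => //; rewrite divr_ge0.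
split=> //.
(* The fibre derivative of g_j along u is [g_(j-1), H_u] - U_j; for j = 1 the bracket is absent, as
   g starts in order 1. *)
have bd u : rn u <= L -> bnd D r0 j (fun x => 'd (g j) x (0, u))
    (s / 6 * gam j + (if j is j'.+2 then brk R * (s * gam j'.+1 * w) else 0)).
  move=> uL; have := bU u uL; case: j j0 IHg {IHU bU} => // -[|j] _ IHg bU.
    by apply: eq_bnd (bndD (bndN bU) (@bnd0 _ _ D r0 1)) => r x rr Dx; rewrite U1E opprK addr0.
  have bb : bnd D r0 j.+2 (bracket (g j.+1) (H u)) (brk R * (s * gam j.+1 * w)).
    rewrite -addn1; apply: bnd_bracket => //.
    - by rewrite mulr_ge0// ltW.
    - exact: hg.
    - by apply: IHg; rewrite ltnSn.
    - exact: bH.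
  apply: eq_bnd (bndD (bndN bU) bb) => r x rr Dx; rewrite UE.
  by rewrite opprB subrK.
set C := s / 6 * gam j + _ in bd.
have H1 : bnd D r0 j (g j) (A * a ^+ j + 2 * C).
  apply: bnd_fibre_integral => //.
  - exact: hg.
  - move=> r x rr Dx; have d0 : 0 <= r0 - r by rewrite subr_ge0 ltW//; case/andP: rr.
    (* As r0 <= 1, the unweighted bound on the zero section implies the weighted one. *)
    have d1 : (r0 - r) ^+ j.-1 <= 1.
      by apply: exprn_ile1 => //; case/andP: rr => rr1 _; rewrite lerBlDr (le_trans r01)// lerDl ltW.
    apply: le_trans (gzero j0 rr Dx); rewrite -[leRHS]mulr1.
    by apply: ler_wpM2l => //; exact: rn_ge0.
  - by move=> r x u rr Dx Du; exact: (bd u (DL rr Du) r x rr Dx).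
apply: bnd_le H1; have := gam_zero j0; rewrite /C.
have sg k : 0 <= s * gam k by rewrite mulr_ge0// ltW.
case: (j) j0 => // -[|j'] _ /=; first by have := sg 1%N; lra.
by have := gam_step j'; lra.
Qed.

Lemma gauge_bounds : exists s l : R, [/\ 0 <= s, 0 < l &
  forall j, (0 < j)%N -> bnd D r0 j (g j) (s * l ^+ j)].
Proof.
exists s, l; split=> //; first exact: ltW.
suff H1 j : (0 < j)%N -> (forall u, rn u <= L -> bnd D r0 j (U u j) (s / 6 * gam j)) /\
    bnd D r0 j (g j) (s * gam j).
  move=> j j0; apply: bnd_le (H1 j j0).2; apply: ler_wpM2l; first exact: ltW.
  rewrite /gam ler_pdivrMr ?exprn_gt0 ?ltr0n// ler_peMr ?exprn_ge0 ?(ltW l_gt0)//.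
  by apply: exprn_ege1; rewrite ler1n.
elim/ltn_ind: j => j IH j0; apply: gauge_step => //.
- by move=> k /andP[k0 kj]; exact: (IH k kj k0).2.
- by move=> k u /andP[k0 kj] uL; exact: (IH k kj k0).1.
Qed.

End GaugeBounds.

(** * From the estimates to the Borel transform *)

Section LocalBounds.
Variables (R : realType) (V : normedModType R[i]).
Implicit Types (phi : V -> R) (x : V).

Definition locally_bounded phi x := exists2 d : R, 0 < d &
  exists B : R, forall y, rn (y - x) < d -> phi y <= B.

Lemma locally_bounded_diff (W : normedModType R[i]) (f : V -> W) x :
  differentiable f x -> locally_bounded (fun y => rn (f y)) x.
Proof.
move=> /differentiable_rn_continuous/(_ 1 ltr01)[d d0 dP]; exists d => //.
exists (rn (f x) + 1) => y /dP h.
rewrite -(subrK (f x) (f y)) addrC; apply: le_trans (rnD _ _) _.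
by rewrite lerD2l ltW.
Qed.

Lemma locally_boundedD phi psi x : locally_bounded phi x -> locally_bounded psi x ->
  locally_bounded (fun y => phi y + psi y) x.
Proof.
move=> [d1 d10 [B1 B1P]] [d2 d20 [B2 B2P]].
exists (Num.min d1 d2); first by rewrite lt_min d10.
exists (B1 + B2) => y; rewrite lt_min => /andP[/B1P h1 /B2P h2]; exact: lerD.
Qed.

Lemma locally_bounded_sum (I : Type) (s : seq I) (phi : I -> V -> R) x :
  (forall i, locally_bounded (phi i) x) ->
  locally_bounded (fun y => \sum_(i <- s) phi i y) x.
Proof.
move=> h; elim: s => [|i s [d d0 [B BP]]].
  by exists 1 => //; exists 0 => y _; rewrite big_nil.
have [d' d'0 [B' B'P]] := locally_boundedD (h i) (ex_intro2 _ _ d d0 (ex_intro _ B BP)).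
by exists d' => //; exists B' => y /B'P; rewrite big_cons.
Qed.

(** Compactness of [0, 1], with one integer k serving both as the bound and, through 1 / (k + 1), as
    the radius, so that the local conditions become weaker as k grows. *)
Lemma segment_bounded phi (x w : V) :
  (forall t : R, 0 <= t <= 1 -> locally_bounded phi (x + t%:C *: w)) ->
  exists2 d : R, 0 < d & exists B : R, forall (t : R) y, 0 <= t <= 1 ->
    rn (y - (x + t%:C *: w)) < d -> phi y <= B.
Proof.
move=> lb.
pose P (k : nat) (t : R) := forall y, rn (y - (x + t%:C *: w)) < k.+1%:R^-1 -> phi y <= k%:R.
have cov : \forall k \near \oo, `[0, 1]%classic `<=` P k.
  have /compact_near_coveringP := @segment_compact R 0 1; apply => t; rewrite /= in_itv /= => t01.
  have [d d0 [B BP]] := lb t t01.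
  have w1 : 0 < 2 * (rn w + 1) by rewrite mulr_gt0// ltr_wpDl// rn_ge0.
  (* Half of d is left for moving t' along the segment, half for the distance of y from it. *)
  exists ([set t' | `|t' - t| < d / (2 * (rn w + 1))], [set k | 2 / d <= k%:R /\ B <= k%:R]).
    split => /=.
      apply/nbhs_ballP; exists (d / (2 * (rn w + 1))); first exact: divr_gt0.
      by move=> t'; rewrite /ball /= distrC.
    exists (maxn (Num.bound (2 / d)) (Num.bound `|B|)) => // k /=.
    rewrite geq_max => /andP[k1 k2]; split.
      have := archi_boundP (divr_ge0 (ler0n _ 2) (ltW d0)) => /ltW h; apply: le_trans h _.
      by rewrite ler_nat.
    apply: le_trans (ler_norm _) _.
    have := archi_boundP (normr_ge0 B) => /ltW h; apply: le_trans h _.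
    by rewrite ler_nat.
  move=> [t' k] /= [ht [hk1 hk2]] y hy; apply: le_trans (BP y _) hk2.
  rewrite -(subr_telescope y (x + t'%:C *: w)); apply: le_lt_trans (rnD _ _) _.
  have -> : x + t'%:C *: w - (x + t%:C *: w) = (t' - t)%:C *: w.
    by rewrite opprD addrACA subrr add0r -scalerBl rmorphB.
  rewrite rnZr [ltRHS]splitr; apply: ltr_leD.
    apply: lt_le_trans hy _; rewrite -[leRHS]invrK lef_pV2 ?posrE ?invr_gt0 ?divr_gt0 ?ltr0n//.
    by rewrite invf_div (le_trans hk1)// ler_nat.
  apply: le_trans (_ : d / (2 * (rn w + 1)) * rn w <= _).
    by apply: ler_wpM2r; [exact: rn_ge0|exact: ltW].
  have -> : d / (2 * (rn w + 1)) * rn w = d / 2 * (rn w / (rn w + 1)).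
    by field; rewrite gt_eqF// ltr_wpDl// rn_ge0.
  apply: ler_piMr; first by rewrite divr_ge0// ltW.
  by rewrite ler_pdivrMr ?ltr_wpDl ?rn_ge0// mul1r lerDl.
have [k _ kP] := cov; have {}kP := kP k (leqnn k).
exists (k.+1%:R^-1); first by rewrite invr_gt0 ltr0n.
by exists k%:R => t y t01; apply: kP; rewrite /= in_itv.
Qed.

End LocalBounds.

(** * Uniform convergence and geometric series *)

Section UniformConvergence.
Variables (R : realType) (n : nat) (T : choiceType).
Local Notation W := (tvec R n).

Lemma uniform_cvg_rn (E : set T) (F : nat -> T -> W) (S : T -> W) :
  (forall e : R, 0 < e -> exists K, forall m, (K <= m)%N -> forall y, E y ->
     rn (F m y - S y) < e) ->
  {uniform E, F @ \oo --> S}.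
Proof.
move=> H P /uniform_nbhs[A [entA AP]].
have := entA; rewrite -entourage_ballE => -[e e0 eA].
have e0' : 0 < complex.Re e by rewrite -ltcR RRe_real// gtr0_real.
have [K KP] := H _ e0'; exists K => // m Km; apply: AP => y Ey; apply: eA => /=.
by rewrite -[e]RRe_real ?gtr0_real// ball_rn rn_distC; exact: KP.
Qed.

Lemma rn_uniform_cvg (E : set T) (F : nat -> T -> W) (S : T -> W) :
  {uniform E, F @ \oo --> S} ->
  forall e : R, 0 < e -> exists K, forall m, (K <= m)%N -> forall y, E y ->
     rn (F m y - S y) < e.
Proof.
move=> H e e0.
have ent : entourage [set yz : W * W | ball yz.1 e%:C yz.2].
  by rewrite -entourage_ballE; exists e%:C => //=; rewrite ltcR.
have : nbhs (S : {uniform` E -> W}) [set h | forall y, E y -> ball (S y) e%:C (h y)].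
  by apply/uniform_nbhs; eexists; split; [exact: ent|].
move=> /H[K _ KP]; exists K => m Km y Ey.
by have := KP m Km y Ey; rewrite ball_rn rn_distC.
Qed.

Lemma geometric_series (t : nat -> W) (C : R) : 0 <= C ->
  (forall k, rn (t k) <= C * (1 / 2) ^+ k) ->
  exists L : W, forall m, rn (\sum_(k < m) t k - L) <= 2 * C * (1 / 2) ^+ m.
Proof.
move=> C0 tC.
(* The exact geometric remainder is subtracted on the right so that the induction on p closes. *)
have tail m p : rn (\sum_(k < m + p) t k - \sum_(k < m) t k) <=
    2 * C * (1 / 2) ^+ m - 2 * C * (1 / 2) ^+ (m + p).
  elim: p => [|p IH]; first by rewrite addn0 !subrr rn0.
  rewrite addnS big_ord_recr /= addrAC; apply: le_trans (rnD _ _) _.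
  have := tC (m + p)%N; rewrite exprS; lra.
have h2 m : 0 <= 2 * C * (1 / 2) ^+ m :> R.
  by rewrite mulr_ge0 ?mulr_ge0// exprn_ge0// divr_ge0.
have tail' m p : (m <= p)%N ->
    rn (\sum_(k < p) t k - \sum_(k < m) t k) <= 2 * C * (1 / 2) ^+ m.
  move=> mp; have := tail m (p - m)%N; rewrite subnKC//; have := h2 p; lra.
have small (e : R) : 0 < e -> exists K, 2 * C * (1 / 2) ^+ K <= e.
  move=> e0; exists (Num.bound (2 * C / e)).
  have := archi_boundP (divr_ge0 (mulr_ge0 (ler0n _ 2) C0) (ltW e0)).
  set K := Num.bound _ => h; rewrite expr_div_n expr1n mul1r ler_pdivrMr ?exprn_gt0//.
  rewrite -ler_pdivrMl// mulrC; apply: le_trans (ltW h) _.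
  by rewrite -natrX ler_nat ltnW// ltn_expl.
have mono k K : (K <= k)%N -> (1 / 2) ^+ k <= (1 / 2) ^+ K :> R.
  by move=> Kk; apply: ler_wiXn2l => //; rewrite ?divr_ge0// ler_pdivrMr// mul1r ler1n.
have [L LP] : exists L : W, forall e : R, 0 < e -> exists K, forall k, (K <= k)%N ->
    rn (\sum_(i < k) t i - L) <= e.
  apply: tvec_cauchy => e e0; have [K KP] := small e e0; exists K.
  have key k l : (K <= k)%N -> (k <= l)%N -> rn (\sum_(i < l) t i - \sum_(i < k) t i) <= e.
    move=> Kk kl; apply: le_trans (tail' _ _ kl) _; apply: le_trans KP.
    by apply: ler_wpM2l; [exact: mulr_ge0|exact: mono].
  move=> k l Kk Kl; case/orP: (leq_total k l) => kl; last exact: key.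
  by rewrite rn_distC; exact: key.
exists L => m; apply/ler_addgt0Pr => e e0; have [K KP] := LP e e0.
pose p := maxn K m.
rewrite -(subr_telescope _ (\sum_(i < p) t i)); apply: le_trans (rnD _ _) (lerD _ _).
  by rewrite rn_distC; apply: tail'; exact: leq_maxr.
by apply: KP; exact: leq_maxl.
Qed.

End UniformConvergence.

(** * Borel convergence and factorial bounds *)

Section Borel.
Variables (R : realType) (n : nat).
Local Notation W := (tvec R n).

(** For |xi| < 1 / (2 l) the k-th term is at most C l / 2^k, uniformly in y. *)
Lemma borel_of_bounds (D : set W) (g : nat -> W -> W) (x : W) (d C l : R) :
  0 < d -> 0 <= C -> 0 < l ->
  (forall j y, (0 < j)%N -> rn (y - x) < d -> rn (g j y) <= C * l ^+ j * (j.-1)`!%:R) ->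
  borel_converges_near D g x.
Proof.
move=> d0 C0 l0 gb.
pose t (y : W * R[i]) k := (y.2 ^+ k / k`!%:R) *: g k.+1 y.1.
pose E := [set y : W * R[i] | [/\ rn (y.1 - x) < d, D y.1 & `|y.2| < (1 / (2 * l))%:C]].
have Cl : 0 <= C * l by rewrite mulr_ge0// ltW.
have tb y : E y -> forall k, rn (t y k) <= C * l * (1 / 2) ^+ k.
  move=> [y1 _ y2] k; rewrite /t rnZ rnM rnX rnV rn_nat.
  move: y2; rewrite -rnE ltcR => y2.
  have f0 : 0 < k`!%:R :> R by rewrite ltr0n fact_gt0.
  have h1 : rn y.2 ^+ k <= (1 / (2 * l)) ^+ k.
    apply: lerXn2r; rewrite ?nnegrE ?rn_ge0//; last exact: ltW.
    by rewrite divr_ge0// mulr_ge0// ltW.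
  have h2 := gb k.+1 y.1 isT y1.
  apply: le_trans (_ : (1 / (2 * l)) ^+ k / k`!%:R * (C * l ^+ k.+1 * k`!%:R) <= _).
    apply: ler_pM; rewrite ?divr_ge0 ?exprn_ge0 ?rn_ge0//.
    by apply: ler_wpM2r; rewrite ?invr_ge0.
  rewrite le_eqVlt; apply/orP; left; apply/eqP.
  rewrite !expr_div_n !expr1n exprMn exprS; field.
  by rewrite !gt_eqF// exprn_gt0.
(* The sum is chosen point by point; outside [E] any value will do, and 0 is taken. *)
have ex y : exists L : W, E y -> forall m, rn (\sum_(k < m) t y k - L) <= 2 * (C * l) * (1 / 2) ^+ m.
  have [Ey|nE] := pselect (E y); last by exists 0.
  by have [L LP] := geometric_series Cl (tb y Ey); exists L.
have [S SP] := choice ex.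
exists [set y | rn (y - x) < d], (1 / (2 * l))%:C, S; split.
- by apply/nbhs_rn; exists d.
- by rewrite ltcR divr_gt0// mulr_gt0.
apply: uniform_cvg_rn => e e0; exists (Num.bound (2 * (C * l) / e)) => m Km y Ey.
apply: le_lt_trans (SP y Ey m) _.
have := archi_boundP (divr_ge0 (mulr_ge0 (ler0n _ 2) Cl) (ltW e0)) => h.
rewrite expr_div_n expr1n mul1r ltr_pdivrMr ?exprn_gt0// -ltr_pdivrMl// mulrC.
apply: lt_trans h _; apply: le_lt_trans (_ : m%:R < _); first by rewrite ler_nat.
by rewrite -natrX ltr_nat ltn_expl.
Qed.

(** Beyond some K the partial sums are within 1/2 of the limit, so every later term has norm less
    than 1; reading this at xi = b / 2, inside the radius b, gives (2 / b)^m m!. The finitely many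
    earlier coefficients are covered by local boundedness. *)
Lemma bounds_of_borel (V : normedModType R[i]) (D : set V) (f : nat -> V -> W) (x : V) :
  nbhs x D -> (forall k, (0 < k)%N -> locally_bounded (fun y => rn (f k y)) x) ->
  borel_converges_near D f x ->
  exists2 d : R, 0 < d & exists A a : R, [/\ 0 <= A, 0 < a &
    forall j y, (0 < j)%N -> rn (y - x) < d -> rn (f j y) <= A * a ^+ j * (j.-1)`!%:R].
Proof.
move=> /nbhs_rn[d1 d10 DP] fb [N [delta [S [/nbhs_rn[d2 d20 NP] delta0 cvg]]]].
have de : delta = (complex.Re delta)%:C by rewrite RRe_real// gtr0_real.
set b := complex.Re delta in de; have b0 : 0 < b by rewrite -ltcR -de.
have half0 : 0 < 1 / 2 :> R by rewrite divr_gt0.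
have [K KP] := rn_uniform_cvg cvg half0.
have [d3 d30 [B BP]] := @locally_bounded_sum R V nat (iota 0 K)
   (fun k y => rn (f k.+1 y)) x (fun k => fb k.+1 isT).
exists (Num.min d1 (Num.min d2 d3)); first by rewrite !lt_min d10 d20.
(* At least 2 / b for the late coefficients, and at least 1 so that a constant bounds the early
   ones. *)
pose a := 1 + 2 / b.
have a1 : 1 <= a by rewrite lerDl divr_ge0// ltW.
have a0 : 0 < a by exact: lt_le_trans a1.
exists (1 + `|B|), a; split; [exact: addr_ge0|exact: a0|].
case=> // m y _; rewrite !lt_min => /and3P[y1 y2 y3] /=.
have B1 : 1 <= 1 + `|B| by rewrite lerDl.
have am : 1 <= a ^+ m.+1 by exact: exprn_ege1.
have [mK|Km] := ltnP m K.
  apply: le_trans (_ : (1 + `|B|) * 1 * 1 <= _); last first.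
    apply: ler_pM => //; rewrite ?mulr_ge0// ?addr_ge0//; last by rewrite ler1n fact_gt0.
    by apply: ler_wpM2l => //; exact: addr_ge0.
  rewrite !mulr1; apply: le_trans (_ : B <= _); last first.
    by apply: le_trans (ler_norm _) _; rewrite lerDr.
  apply: le_trans (BP y y3); rewrite (bigD1_seq m)/= ?iota_uniq ?mem_iota//.
  by rewrite lerDl sumr_ge0// => i _; exact: rn_ge0.
pose xi : R[i] := (b / 2)%:C.
have Ey : [/\ N y, D y & `|xi| < delta].
  split; [exact: NP|exact: DP|].
  rewrite -rnE de ltcR rn_real gtr0_norm ?divr_gt0//.
  by rewrite ltr_pdivrMr// ltr_pMr// ltr1n.
have h1 := KP m Km (y, xi) Ey; have h2 := KP m.+1 (leqW Km) (y, xi) Ey.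
have : rn ((xi ^+ m / m`!%:R) *: f m.+1 y) < 1.
  rewrite [ltRHS](splitr 1); apply: le_lt_trans (ltrD h2 h1); move: h1 h2 => _ _ /=.
  rewrite big_ord_recr /=.
  set s := \sum_(i < m) _; set z := _ *: f m.+1 y.
  have {1}-> : z = (s + z - S (y, xi)) - (s - S (y, xi)).
    by rewrite opprB subr_telescope addrC addKr.
  exact: rnB.
rewrite rnZ rnM rnX rnV rn_nat rn_real gtr0_norm ?divr_gt0// => h.
have f0 : 0 < m`!%:R :> R by rewrite ltr0n fact_gt0.
have bm : 0 < (b / 2) ^+ m by rewrite exprn_gt0// divr_gt0.
have h3 : rn (f m.+1 y) <= (2 / b) ^+ m * m`!%:R.
  have E : (2 / b) ^+ m = ((b / 2) ^+ m)^-1 by rewrite -exprVn invf_div.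
  rewrite E -[leRHS]mulr1 -ler_pdivrMl ?mulr_gt0 ?invr_gt0//.
  apply: le_trans (ltW h); rewrite le_eqVlt; apply/orP; left; apply/eqP.
  by field; rewrite !gt_eqF.
apply: le_trans h3 _; apply: ler_wpM2r => //.
rewrite -[leLHS]mul1r; apply: ler_pM => //; first by rewrite exprn_ge0// divr_ge0// ltW.
apply: le_trans (_ : a ^+ m <= _).
  by apply: lerXn2r; rewrite ?nnegrE ?divr_ge0 ?(ltW a0) ?(ltW b0)// lerDr.
by apply: ler_weXn2l.
Qed.

(** Reduces bounds uniform in the lifted vector u to the finitely many lifts of the basis
    vectors. *)
Lemma linear_rn_bound (f : 'rV[R[i]]_n -> W) u :
  (forall (c : R[i]) v w, f (c *: v + w) = c *: f v + f w) ->
  rn (f u) <= rn u * \sum_(i <- enum 'I_n) rn (f (delta_mx 0 i)).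
Proof.
move=> lf; pose F : {linear 'rV[R[i]]_n -> W} := HB.pack f (GRing.isLinear.Build _ _ _ _ f lf).
have -> : f u = \sum_(i <- enum 'I_n) u 0 i *: f (delta_mx 0 i).
  rewrite -[f]/(F : _ -> _) {1}(row_sum_delta u) linear_sum big_enum /=.
  by apply: eq_bigr => i _; rewrite -[f]/(F : _ -> _) linearZ.
apply: le_trans (rn_sum _ _ _) _; rewrite mulr_sumr; apply: ler_sum => i _.
by rewrite rnZ; apply: ler_wpM2r; [exact: rn_ge0|exact: rn_row].
Qed.

End Borel.

(** * Convergence on TM from convergence on the zero section *)

Section GaugeConvergence.
Variables (R : realType) (n : nat) (M : complex_manifold R n).
Implicit Types (g : nat -> chart_ix M -> tvec R n -> tvec R n).

Lemma chart_img_ball (a : chart_ix M) z : chart_img a z ->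
  exists2 r : R, 0 < r & forall y, rn (y - z) < r -> chart_img a y.
Proof.
by apply: open_rn; apply: chart_open; [exact: chart_dom_open|].
Qed.

Lemma borel_converges_zero_section g : borel_converges g -> zero_section_converges g.
Proof.
move=> bg a z az; have [N [delta [S [/nbhs_rn[d d0 NP] delta0 cvg]]]] := bg a (z, 0) az.
exists [set y | rn (y - z) < d], delta, (fun y => S ((y.1, 0), y.2)); split => //.
  by apply/nbhs_rn; exists d.
apply: uniform_cvg_rn => e e0; have [K KP] := rn_uniform_cvg cvg e0.
exists K => m Km y [y1 y2 y3]; apply: (KP m Km ((y.1, 0), y.2)); split => //=.
by apply: NP; rewrite rn_pair /= subrr rn0 gt_max y1 d0.
Qed.

Lemma vanishing_zero_section_converges g :
  vanishes_on_zero_section g -> zero_section_converges g.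
Proof.
move=> g0 a z az; exists [set: _], 1, (fun=> 0); split; [exact: filterT|exact: ltr01|].
apply: uniform_cvg_rn => e e0; exists 0%N => m _ y [_ y2 _].
by rewrite big1 ?subr0 ?rn0// => k _; rewrite g0// scaler0.
Qed.

(* The domains D r are the tubes of radius r around the segment from (z0, 0) to x,
   so that they are stable under contraction of the fibre coordinate. *)
Lemma gauge_borel_converges (G : christoffel M) (h : bundle_map M) g :
  connection (Hconn G) -> connection h -> Lie_G g -> gauge_relates g (Hconn G) h ->
  zero_section_converges g -> borel_converges g.
Proof.
move=> cH ch hg gr zc a x ax; pose z0 := x.1; pose th := x.2.
have [r1 r10 r1P] := chart_img_ball ax.
have gd k y : (0 < k)%N -> tchart_img a y -> differentiable (g k a) y.
  by move=> k0; exact: ((hg k k0).1.1 a).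
have pE (t : R) : (z0, 0) + t%:C *: (0, th) = (z0, t%:C *: th) :> tvec R n.
  by congr pair; rewrite /= ?scaler0 ?addr0 ?add0r.
pose e_ i : 'rV[R[i]]_n := delta_mx 0 i.
(* Controls both connections on the basis vectors, hence by linearity on all u of norm at most L. *)
pose phi (y : tvec R n) := \sum_(i <- enum 'I_n) rn (Hconn G a y (e_ i)) +
   \sum_(i <- enum 'I_n) rn (h a y (e_ i)).
have [d d0 [B BP]] : exists2 d : R, 0 < d & exists B : R, forall (t : R) y, 0 <= t <= 1 ->
    rn (y - ((z0, 0) + t%:C *: (0, th))) < d -> phi y <= B.
  apply: segment_bounded => t _; rewrite pE; apply: locally_boundedD;
    apply: locally_bounded_sum => i; apply: locally_bounded_diff.
  - exact: (connection_holo cH).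
  - exact: (connection_holo ch).
have [d2 d20 [A [b [A0 b0 zb]]]] : exists2 d : R, 0 < d & exists A b : R, [/\ 0 <= A, 0 < b &
    forall j y, (0 < j)%N -> rn (y - z0) < d -> rn (g j a (y, 0)) <= A * b ^+ j * (j.-1)`!%:R].
  apply: (@bounds_of_borel R n _ (chart_img a) (fun j y => g j a (y, 0)) z0 _ _ (zc a z0 ax)).
    by apply/nbhs_rn; exists r1.
  move=> k k0; have [d' d'0 [B' B'P]] := locally_bounded_diff (gd k (z0, 0) k0 ax).
  exists d' => //; exists B' => y yd; apply: B'P.
  by rewrite rn_pair /= subrr rn0 gt_max yd d'0.
(* The four terms give r0 <= 1, tubes inside the chart, the bound on [phi], and the bounds on the
   zero section. *)
pose r0 := Num.min (Num.min 1 r1) (Num.min d d2).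
have r00 : 0 < r0 by rewrite !lt_min ltr01 r10 d0 d20.
have [r01 r0r1 r0d r0d2] : [/\ r0 <= 1, r0 <= r1, r0 <= d & r0 <= d2].
  by rewrite /r0; split; rewrite !ge_min lexx ?orbT.
pose D (r : R) : set (tvec R n) := [set y | exists2 t : R, 0 <= t <= 1 &
   rn (y - ((z0, 0) + t%:C *: (0, th))) < r].
have D_near : forall (r s : R) x y, D r x -> rn (y - x) < s -> D (r + s) y.
  move=> r s y y' [t t01 yr] ys; exists t => //.
  rewrite -(subr_telescope y' y); apply: le_lt_trans (rnD _ _) _; rewrite addrC; exact: ltrD.
have D_star : forall r y (t : R), D r y -> 0 <= t <= 1 -> D r (y.1, t%:C *: y.2).
  move=> r y t [u /andP[u0 u1]]; rewrite pE => yr /andP[t0 t1].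
  exists (t * u); first by rewrite mulr_ge0// mulr_ile1.
  rewrite pE; apply: le_lt_trans yr; apply: rn_pair_le => /=; first exact: (rn_fst (y - (z0, u%:C *: th))).
  rewrite rmorphM -scalerA -scalerBr rnZr ger0_norm//.
  by apply: le_trans (rn_snd (y - (z0, u%:C *: th))); apply: ler_piMl => //; exact: rn_ge0.
have D1 r y : D r y -> rn (y.1 - z0) < r.
  by move=> [t _]; rewrite pE; apply: le_lt_trans; exact: (rn_fst (y - (z0, t%:C *: th))).
have Dchart r y : 0 < r < r0 -> D r y -> tchart_img a y.
  move=> /andP[_ rr0] /D1 yr; apply: r1P; apply: lt_le_trans r0r1; exact: lt_trans rr0.
(* A point of a tube has fibre coordinate within r0 <= 1 of some t th with t <= 1. *)
pose L := 1 + rn th.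
have L0 : 0 <= L by rewrite addr_ge0// rn_ge0.
have phiB r y : 0 < r < r0 -> D r y -> phi y <= `|B|.
  move=> /andP[_ rr0] [t t01 yr]; apply: le_trans (ler_norm _); apply: (BP t) => //.
  by apply: lt_le_trans r0d; exact: lt_trans rr0.
have cb (h' : bundle_map M) u r y : connection h' ->
    \sum_(i <- enum 'I_n) rn (h' a y (e_ i)) <= phi y -> rn u <= L ->
    0 < r < r0 -> D r y -> rn (h' a y u) <= L * `|B|.
  move=> ch' hp uL rr Dy.
  apply: le_trans (linear_rn_bound u (connection_linear ch' (Dchart _ _ rr Dy))) _.
  apply: ler_pM => //; [exact: rn_ge0|by rewrite sumr_ge0// => i _; exact: rn_ge0|].
  exact: le_trans hp (phiB _ _ rr Dy).
have sum0 (h' : bundle_map M) y : 0 <= \sum_(i <- enum 'I_n) rn (h' a y (e_ i)).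
  by rewrite sumr_ge0// => i _; exact: rn_ge0.
have oU : open [set z : 'rV[R[i]]_n | rn (z - z0) < r1].
  rewrite openE => z zr; apply/nbhs_rn; exists (r1 - rn (z - z0)); first by rewrite subr_gt0.
  move=> y yz; rewrite /= -(subr_telescope y z); apply: le_lt_trans (rnD _ _) _.
  by rewrite -ltrBrDr.
have lv u : local_vfield a [set z : 'rV[R[i]]_n | rn (z - z0) < r1] (fun=> u).
  by split=> // z _; exact: differentiable_cst.
have [s [l [s0 l0 bg]]] : exists s l : R, [/\ 0 <= s, 0 < l &
    forall j, (0 < j)%N -> bnd D r0 j (g j a) (s * l ^+ j)].
  apply: (@gauge_bounds R n D r0 r01 D_near D_star (fun k => g k a)
    (fun u y => Hconn G a y u) (fun u y => h a y u) _ _ _ L (L * `|B|) A b) => //.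
  - by move=> k k0 r y rr Dy; exact: gd k0 (Dchart _ _ rr Dy).
  - by move=> u r y rr Dy; exact: (connection_holo cH u (Dchart _ _ rr Dy)).
  - move=> u j r y j0 rr Dy.
    have := gr a _ _ (lv u) j y; rewrite /exp_formal_Lie => E.
    rewrite [LHS]E; last by case/andP: rr => _ rr0; apply: lt_le_trans (lt_trans (D1 _ _ Dy) rr0) r0r1.
    by case: j j0 {E} => // -[|j].
  - by rewrite mulr_ge0.
  - move=> u uL r y rr Dy; rewrite expr0 fact0 !mulr1.
    by apply: cb rr Dy => //; rewrite /phi lerDl; exact: sum0.
  - move=> u uL r y rr Dy; rewrite expr0 fact0 !mulr1.
    by apply: cb rr Dy => //; rewrite /phi lerDr; exact: sum0.
  - move=> r y /andP[_ rr0] [t /andP[t0 t1]]; rewrite pE => yr.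
    rewrite -(subrK (t%:C *: th) y.2); apply: le_trans (rnD _ _) (lerD _ _).
      apply: le_trans (rn_snd (y - (z0, t%:C *: th))) _.
      by apply: le_trans (ltW yr) _; apply: le_trans (ltW rr0) _.
    by rewrite rnZr ger0_norm//; apply: ler_piMl => //; exact: rn_ge0.
  - move=> j r y j0 /andP[_ rr0] Dy; apply: zb => //.
    by apply: lt_le_trans r0d2; apply: lt_trans (D1 _ _ Dy) rr0.
(* The bounds are read at radius r0 / 2, on the ball about x, the end t = 1 of the segment; since 2
   / r0 >= 1, its power j - 1 may be replaced by the power j. *)
have h0 : 0 < r0 / 2 by rewrite divr_gt0.
have c1 : 1 <= 2 / r0 by rewrite ler_pdivlMr// mul1r; lra.
apply: (@borel_of_bounds R n _ _ x (r0 / 2) s (2 / r0 * l)) => //.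
  by rewrite mulr_gt0// divr_gt0.
move=> j y j0 yx.
have rr : 0 < r0 / 2 < r0 by rewrite h0 /= ltr_pdivrMr// ltr_pMr// ltr1n.
have Dy : D (r0 / 2) y.
  exists 1; first by rewrite ler01 lexx.
  by rewrite pE rmorph1 scale1r /z0 /th; case: (x) yx.
have := bg j j0 _ _ rr Dy; have -> : r0 - r0 / 2 = r0 / 2 by field.
rewrite -ler_pdivlMr ?exprn_gt0// => H; apply: le_trans H _.
have -> : s * l ^+ j * (j.-1)`!%:R / (r0 / 2) ^+ j.-1 =
   (2 / r0) ^+ j.-1 * (s * l ^+ j * (j.-1)`!%:R).
  by rewrite -[2 / r0]invf_div exprVn mulrC.
have -> : s * (2 / r0 * l) ^+ j * (j.-1)`!%:R = (2 / r0) ^+ j * (s * l ^+ j * (j.-1)`!%:R).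
  by rewrite exprMn; ring.
apply: ler_wpM2r; first by rewrite !mulr_ge0// exprn_ge0// ltW.
by apply: ler_weXn2l => //; exact: leq_pred.
Qed.

End GaugeConvergence.

Theorem theorem4p3 (R : realType) (n : nat) (M : complex_manifold R n)
    (omega : chart_ix M -> 'rV[R[i]]_n -> 'M[R[i]]_n)
    (Gamma : chart_ix M -> 'rV[R[i]]_n -> set 'rV[R[i]]_n)
    (G : christoffel M) (Z : chart_ix M -> 'rV[R[i]]_n -> 'rV[R[i]]_n)
    (h : bundle_map M) (hJ : Joyce_structure omega Gamma G Z h) :
  (forall g : nat -> chart_ix M -> tvec R n -> tvec R n,
     Lie_G g -> gauge_relates g (Hconn G) h ->
     (borel_converges g <-> zero_section_converges g)) /\
  (forall g : nat -> chart_ix M -> tvec R n -> tvec R n,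
     Lie_G g -> gauge_relates g (Hconn G) h -> vanishes_on_zero_section g ->
     borel_converges g).
Proof.
have cH := linear_connection_conn (period_connection (Joyce_period hJ)).
have ch := pre_Joyce_connection (Joyce_pre hJ).
split=> g hg gr; first split.
- exact: borel_converges_zero_section.
- exact: gauge_borel_converges cH ch hg gr.
- by move/vanishing_zero_section_converges; exact: gauge_borel_converges cH ch hg gr.
Qed.
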